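(* Let $\mathbf{A}\neq\mathbf{0}$ be a real $m\times n$ matrix, let $0<\beta\leq 1$, and let $\mathbf{X}$ be computed by the sampling algorithm (described in the context) with $c$ samples and ``nearly optimal'' probabilities $p_j^{\beta}$, i.e. $\sum_{j=1}^n p_j^{\beta}=1$ and $p_j^{\beta}\geq\beta\,\|A_j\|_2^2/\|\mathbf{A}\|_F^2$ for $1\leq j\leq n$. Given $0<\delta<1$ and $0<\epsilon\leq 1$, if $$c\geq c_0(\epsilon)\,\mathsf{sr}(\mathbf{A})\,\frac{\ln(4\,\mathsf{sr}(\mathbf{A})/\delta)}{\beta\,\epsilon^2},\qquad\text{where}\quad c_0(\epsilon)\equiv 2+\frac{2\epsilon}{3},$$ then with probability at least $1-\delta$, $$\frac{\|\mathbf{X}-\mathbf{A}\mathbf{A}^T\|_2}{\|\mathbf{A}\mathbf{A}^T\|_2}\leq\epsilon.$$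
   Context: $\|\cdot\|_2$ is the two-norm (spectral norm for matrices), $\|\cdot\|_F$ the Frobenius norm, and $A_1,\ldots,A_n$ are the columns of $\mathbf{A}$. The stable rank of $\mathbf{A}\neq\mathbf{0}$ is $\mathsf{sr}(\mathbf{A})\equiv\|\mathbf{A}\|_F^2/\|\mathbf{A}\|_2^2$. Sampling algorithm: given a real $m\times n$ matrix $\mathbf{A}$, a number of samples $1\leq c\leq n$ and probabilities $p_j\geq 0$ with $\sum_{j=1}^n p_j=1$, sample indices $t_1,\ldots,t_c$ from $\{1,\ldots,n\}$ independently and with replacement, with $\mathbb{P}[t_j=i]=p_i$; let $\mathbf{S}$ be the $n\times c$ matrix with columns $e_{t_j}/\sqrt{c\,p_{t_j}}$ ($e_i$ being the columns of $\mathbf{I}_n$); output $$\mathbf{X}=(\mathbf{A}\mathbf{S})(\mathbf{A}\mathbf{S})^T=\sum_{j=1}^c\frac{1}{c\,p_{t_j}}A_{t_j}A_{t_j}^T.$$ An index $i$ with $p_i=0$ is never selected. *)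

(* Defs.v *)
From HB Require Import structures.
From mathcomp Require Import all_boot all_order all_algebra.
From mathcomp Require Import all_classical all_reals all_analysis.

Set Implicit Arguments.
Unset Strict Implicit.
Unset Printing Implicit Defensive.

Import Order.TTheory GRing.Theory Num.Theory.

Local Open Scope classical_set_scope.
Local Open Scope ring_scope.

Definition vnorm2 (R : realType) (n : nat) (x : 'cV[R]_n) : R :=
  Num.sqrt (\sum_(i < n) x i 0 ^+ 2).

                                                                               
Definition spectral_norm (R : realType) (m n : nat) (A : 'M[R]_(m, n)) : R :=
  sup [set vnorm2 (A *m x) | x in [set x : 'cV[R]_n | vnorm2 x <= 1]].

Definition frobenius_norm (R : realType) (m n : nat) (A : 'M[R]_(m, n)) : R :=
  Num.sqrt (\sum_(i < m) \sum_(j < n) A i j ^+ 2).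

Definition stable_rank (R : realType) (m n : nat) (A : 'M[R]_(m, n)) : R :=
  frobenius_norm A ^+ 2 / spectral_norm A ^+ 2.

(* Meant for random variables with values in a discrete space U, where every
   subset B j is measurable. *)
Definition mutually_independent (R : realType) (d : measure_display)
    (T : measurableType d) (P : probability T R) (I : finType) (U : Type)
    (t : I -> T -> U) : Prop :=
  forall (J : {set I}) (B : I -> set U),
    P (\bigcap_(j in [set` J]) (t j @^-1` B j)) =
    (\prod_(j in J) P (t j @^-1` B j))%E.

                                                                             
                 
Definition iid_indices (R : realType) (d : measure_display)
    (T : measurableType d) (P : probability T R) (n c : nat)
    (p : 'I_n -> R) (t : 'I_c -> T -> 'I_n) : Prop :=
  [/\ forall j (B : set 'I_n), measurable (t j @^-1` B),
      forall j i, P (t j @^-1` [set i]) = (p i)%:E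
    & mutually_independent P t].

                                                                             
                                                            
Definition sampling_matrix (R : realType) (n c : nat) (p : 'I_n -> R)
    (s : 'I_c -> 'I_n) : 'M[R]_(n, c) :=
  \matrix_(i < n, j < c) ((i == s j)%:R / Num.sqrt (c%:R * p (s j))).

Definition sampled_gram (R : realType) (m n c : nat) (A : 'M[R]_(m, n))
    (p : 'I_n -> R) (s : 'I_c -> 'I_n) : 'M[R]_m :=
  (A *m sampling_matrix p s) *m (A *m sampling_matrix p s)^T.

Definition nearly_optimal (R : realType) (m n : nat) (A : 'M[R]_(m, n))
    (beta : R) (p : 'I_n -> R) : Prop :=
  [/\ forall j, 0 <= p j,
      \sum_(j < n) p j = 1
    & forall j, beta * (vnorm2 (col j A) ^+ 2 / frobenius_norm A ^+ 2) <= p j].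

Definition c0 (R : realType) (eps : R) : R := 2 + 2 * eps / 3.

(* Main.v *)
Require Import Defs.
From HB Require Import structures.
From mathcomp Require Import all_boot all_order all_algebra.
From mathcomp Require Import all_classical all_reals all_analysis.
From mathcomp Require Import complex ring lra.

(** The sampled matrix minus the Gram matrix is a sum of [c] independent,
    identically distributed, centered symmetric matrices, so the bound is a
    matrix Bernstein inequality in which the dimension is replaced by the
    intrinsic dimension [\tr V / ||V||] of a matrix [V] dominating the variance;
    here [V] is proportional to [A A^T] and this ratio is the stable rank.

    The usual proof of such an inequality goes through Lieb's concavity theorem.
    For identically distributed summands the Golden-Thompson inequality is
    enough.  Let [Y] be a partial sum, [X] the next summand,
    [D = E exp X - 1] and [psi x = exp x - 1 - x], which is nonnegative.  Then
    [E \tr exp (Y + X) <= E \tr (exp Y * exp X) = E \tr (exp Y * (1 + D))],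
    and writing [exp Y = 1 + Y + psi Y] gives
    [E \tr (exp Y * D) = \tr D + E \tr (Y * D) + E \tr (psi Y * D)].
    The middle term vanishes because [Y] is centered: the part of the
    exponential that [psi] misses costs nothing.  Since [D <= g V <= g v] by the
    scalar Bernstein estimate ([euler_bernstein]), the last term is at most [g v * E \tr (psi Y)],
    and the first at most [s * (g v)] when [\tr V <= s v].  As
    [E \tr (psi Y) = E \tr (exp Y - 1)], this is the recursion
    [f (k+1) <= (1 + g v) f k + s * (g v)] for [f k = E \tr (psi (Y_k))], whence
    [f c <= s * ((1 + g v)^c - 1)] ([mean_psi_step], [iid_mean_psi]).  Markov's
    inequality for [psi] bounds the upper tail of the largest eigenvalue
    ([bernstein_intdim]); the summands and their opposites give both tails, and
    because the exponent is at least [ln (4 s / delta)] the factor 4 absorbs the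
    two tails together with the difference between [psi] and [exp]
    ([tail_prob_le]).

    No matrix exponential is used.  It is replaced by Euler's approximation
    [(1 + Y / N)^N] with [N] a power of two, for which the Golden-Thompson
    inequality holds up to [O(1/N)] and is purely algebraic: it comes from
    [\tr ((P Q)^N) <= \tr (P^N Q^N)] for symmetric [P] and [Q]
    ([mxtraceX_two_power], [golden_thompson_euler]).  The exponential returns in
    the limit, for scalars only.  Scalar inequalities pass to matrices through a
    tight frame of eigenvectors ([sym_eigenframe]). *)

Set Implicit Arguments.
Unset Strict Implicit.
Unset Printing Implicit Defensive.

Import Order.TTheory GRing.Theory Num.Theory.

Local Open Scope classical_set_scope.
Local Open Scope ring_scope.

(** * A trace inequality for powers of products *)

Lemma trmxX (R : comNzRingType) n (M : 'M[R]_n) k : (M ^+ k)^T = M^T ^+ k.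
Proof.
elim: k => [|k IH]; first by rewrite !expr0 trmx1.
by rewrite exprS exprSr trmx_mul IH.
Qed.

Lemma mxtraceX_mulC (R : comNzRingType) n (P Q : 'M[R]_n) k :
  \tr ((P * Q) ^+ k) = \tr ((Q * P) ^+ k).
Proof.
case: k => [//|k].
have E : P * Q * (P * Q) ^+ k = P * ((Q * P) ^+ k * Q).
  elim: k => [|k IH]; first by rewrite !expr0 mulr1 mul1r.
  by rewrite exprSr mulrA IH exprSr !mulrA.
by rewrite exprS E mxtrace_mulC exprSr !mulrA.
Qed.

Lemma mxtrace_tr_mul_ge0 (R : realDomainType) n (M : 'M[R]_n) :
  0 <= \tr (M *m M^T).
Proof.
rewrite /mxtrace sumr_ge0 // => i _; rewrite mxE sumr_ge0 // => j _.
by rewrite mxE -expr2 sqr_ge0.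
Qed.

Lemma mxtrace_mul_le_half (R : realFieldType) n (M M' : 'M[R]_n) :
  \tr (M * M') *+ 2 <= \tr (M * M^T) + \tr (M'^T * M').
Proof.
have := mxtrace_tr_mul_ge0 (M - M'^T).
rewrite [(M - _)^T]raddfB /= trmxK mulmxBl !mulmxBr !raddfB /=.
have -> : \tr (M'^T *m M^T) = \tr (M *m M') by rewrite -trmx_mul mxtrace_tr.
by rewrite mulr2n -![_ *m _]/(_ * _); lra.
Qed.

(** Both inequalities are proved together by induction on the exponent.  With
    [M := P Q], the second one and a cyclic rotation turn [(P Q)^(2^(k+1))] into
    [(P^2 Q^2)^(2^k)], to which the first one applies.  Conversely the second
    one for [M^2] produces, after a rotation, the product of the two symmetric
    matrices [M M^T] and [M^T M], which have equal power traces; the first one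
    separates them and Cauchy-Schwarz concludes. *)
Lemma mxtraceX_two_power (R : realFieldType) n k :
  (forall P Q : 'M[R]_n, P^T = P -> Q^T = Q ->
     \tr ((P * Q) ^+ (2 ^ k)) <= \tr (P ^+ (2 ^ k) * Q ^+ (2 ^ k))) /\
  (forall M : 'M[R]_n, \tr (M ^+ (2 ^ k.+1)) <= \tr ((M * M^T) ^+ (2 ^ k))).
Proof.
have GTstep j : (forall P Q : 'M[R]_n, P^T = P -> Q^T = Q ->
     \tr ((P * Q) ^+ (2 ^ j)) <= \tr (P ^+ (2 ^ j) * Q ^+ (2 ^ j))) ->
  (forall M : 'M[R]_n, \tr (M ^+ (2 ^ j.+1)) <= \tr ((M * M^T) ^+ (2 ^ j))) ->
  (forall P Q : 'M[R]_n, P^T = P -> Q^T = Q ->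
     \tr ((P * Q) ^+ (2 ^ j.+1)) <= \tr (P ^+ (2 ^ j.+1) * Q ^+ (2 ^ j.+1))).
  move=> GT W P Q sP sQ.
  apply: (le_trans (W _)).
  have -> : (P * Q) * (P * Q)^T = P * (Q ^+ 2 * P).
    by rewrite trmx_mul sP sQ expr2 !mulrA.
  rewrite mxtraceX_mulC -mulrA -expr2 mxtraceX_mulC expnS !exprM.
  by apply: GT; rewrite trmxX ?sP ?sQ.
elim/ltn_ind: k => k IH.
have GT : forall P Q : 'M[R]_n, P^T = P -> Q^T = Q ->
     \tr ((P * Q) ^+ (2 ^ k)) <= \tr (P ^+ (2 ^ k) * Q ^+ (2 ^ k)).
  by case: k IH => [//|k] IH; have [G W] := IH k (ltnSn k); apply: GTstep.
split=> // M.
case: k IH {GT} => [|k] IH.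
  have := mxtrace_mul_le_half M M.
  rewrite expn0 expr1 expn1 expr2 (mxtrace_mulC M^T) -[_ *m _]/(_ * _).
  by rewrite mulr2n; lra.
have [GT W] := IH k (ltnSn k).
rewrite expnS exprM.
apply: (le_trans (W _)).
have -> : M ^+ 2 * (M ^+ 2)^T = M * (M * M^T * M^T).
  by rewrite trmxX !expr2 !mulrA.
(* Cyclic rotation regroups the word as [(M M^T) (M^T M)] *)
rewrite mxtraceX_mulC -(mulrA (M * M^T)).
set B := M * M^T; set C := M^T * M.
have sB : B^T = B by rewrite trmx_mul trmxK.
have sC : C^T = C by rewrite trmx_mul trmxK.
apply: (le_trans (GT _ _ sB sC)).
have := mxtrace_mul_le_half (B ^+ (2 ^ k)) (C ^+ (2 ^ k)).
rewrite !trmxX sB sC -!exprD addnn -mul2n -expnS.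
by rewrite /C mxtraceX_mulC -/B mulr2n; lra.
Qed.

(** * The Golden-Thompson inequality for Euler powers *)

(** Any submultiplicative norm would do: it serves only to control errors that
    vanish as the Euler exponent grows. *)
Definition sumnorm (R : realType) n (M : 'M[R]_n) : R := \sum_i \sum_j `|M i j|.

Lemma sumnorm_ge0 (R : realType) n (M : 'M[R]_n) : 0 <= sumnorm M.
Proof. by apply: sumr_ge0 => i _; apply: sumr_ge0. Qed.

Lemma sumnormD (R : realType) n (M M' : 'M[R]_n) :
  sumnorm (M + M') <= sumnorm M + sumnorm M'.
Proof.
rewrite /sumnorm -big_split ler_sum// => i _.
by rewrite -big_split ler_sum// => j _; rewrite mxE ler_normD.
Qed.

Lemma sumnorm_sum (R : realType) d (J : finType) (F : J -> 'M[R]_d) b :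
  (forall j, sumnorm (F j) <= b) -> sumnorm (\sum_j F j) <= #|J|%:R * b.
Proof.
move=> Fb; rewrite mulr_natl -sumr_const.
elim/big_rec2: _ => [|j u v' _ IH].
  by rewrite /sumnorm big1// => i _; rewrite big1// => l _; rewrite mxE normr0.
by rewrite (le_trans (sumnormD _ _))// lerD.
Qed.


Lemma sumnormZ (R : realType) n a (M : 'M[R]_n) : sumnorm (a *: M) = `|a| * sumnorm M.
Proof.
rewrite /sumnorm mulr_sumr; apply: eq_bigr => i _; rewrite mulr_sumr.
by apply: eq_bigr => j _; rewrite mxE normrM.
Qed.

Lemma sumnormM (R : realType) n (M M' : 'M[R]_n) :
  sumnorm (M * M') <= sumnorm M * sumnorm M'.
Proof.
rewrite {1 2}/sumnorm mulr_suml ler_sum// => i _.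
apply: (@le_trans _ _ (\sum_j \sum_k `|M i k| * `|M' k j|)).
  apply: ler_sum => j _; rewrite mxE; apply: le_trans (ler_norm_sum _ _ _) _.
  by apply: ler_sum => k _; rewrite normrM.
rewrite exchange_big mulr_suml ler_sum// => k _ /=.
rewrite -mulr_sumr ler_wpM2l// [leRHS](bigD1 k)//= lerDl.
by apply: sumr_ge0 => l _; apply: sumr_ge0.
Qed.

Lemma sumnorm1 (R : realType) n : sumnorm (1 : 'M[R]_n) = n%:R.
Proof.
rewrite /sumnorm -[RHS]mulr1 mulr_natl -[in RHS](card_ord n) -sumr_const.
apply: eq_bigr => i _; rewrite (bigD1 i)//= big1 => [|j ji].
  by rewrite mxE eqxx normr1 addr0.
by rewrite mxE eq_sym (negPf ji) normr0.
Qed.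

Lemma ler_mxtrace_sumnorm (R : realType) n (M : 'M[R]_n) : \tr M <= sumnorm M.
Proof.
apply: ler_sum => i _; apply: (le_trans (ler_norm _)).
by rewrite (bigD1 i)//= lerDl sumr_ge0.
Qed.

Lemma sumnorm_exp1D (R : realType) n (W : 'M[R]_n) w k :
  sumnorm W <= w -> sumnorm ((1 + W) ^+ k) <= n%:R * (1 + w) ^+ k.
Proof.
move=> Ww; elim: k => [|k IH]; first by rewrite !expr0 sumnorm1 mulr1.
rewrite exprSr mulrDr mulr1 exprSr mulrA mulrDr mulr1.
apply: (le_trans (sumnormD _ _)); apply: lerD => //.
apply: (le_trans (sumnormM _ _)).
by apply: ler_pM => //; apply: sumnorm_ge0.
Qed.

Lemma sumnorm_exp1D_sub (R : realType) n (W W' : 'M[R]_n) w dlt k :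
  sumnorm W <= w -> sumnorm W' <= w -> sumnorm (W - W') <= dlt ->
  sumnorm ((1 + W) ^+ k - (1 + W') ^+ k) <= n%:R * k%:R * (1 + w) ^+ k * dlt.
Proof.
move=> Ww W'w Wd; have w0 : 0 <= w := le_trans (sumnorm_ge0 W) Ww.
have d0 : 0 <= dlt := le_trans (sumnorm_ge0 _) Wd.
elim: k => [|k IH].
  rewrite !expr0 subrr mulr0 !mul0r.
  by rewrite -[X in sumnorm X](scale0r (1 : 'M[R]_n)) sumnormZ normr0 mul0r.
have -> : (1 + W) ^+ k.+1 - (1 + W') ^+ k.+1 =
    ((1 + W) ^+ k - (1 + W') ^+ k) + ((1 + W) ^+ k - (1 + W') ^+ k) * W'
    + (1 + W) ^+ k * (W - W').
  have -> : W - W' = (1 + W) - (1 + W') by rewrite opprD addrACA subrr add0r.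
  rewrite !exprSr; set a := (1 + W) ^+ k; set b := (1 + W') ^+ k.
  rewrite -{1}[a - b]mulr1 -mulrDr mulrBl mulrBr [RHS]addrC.
  by rewrite addrA subrK.
apply: (le_trans (sumnormD _ _)).
have H1 : sumnorm ((1 + W) ^+ k - (1 + W') ^+ k +
                   ((1 + W) ^+ k - (1 + W') ^+ k) * W') <=
   n%:R * k%:R * (1 + w) ^+ k * dlt * (1 + w).
  apply: (le_trans (sumnormD _ _)); rewrite mulrDr mulr1 lerD//.
  apply: (le_trans (sumnormM _ _)).
  by apply: ler_pM => //; apply: sumnorm_ge0.
have H2 : sumnorm ((1 + W) ^+ k * (W - W')) <= n%:R * (1 + w) ^+ k * dlt * (1 + w).
  apply: (le_trans (sumnormM _ _)).
  apply: (@le_trans _ _ (n%:R * (1 + w) ^+ k * dlt)).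
    by apply: ler_pM; rewrite ?sumnorm_ge0 ?sumnorm_exp1D.
  by rewrite ler_peMr ?lerDl// !mulr_ge0 ?exprn_ge0 ?addr_ge0 ?ler01.
apply: (le_trans (lerD H1 H2)).
rewrite le_eqVlt; apply/orP; left; apply/eqP.
by rewrite exprSr -[k.+1]addn1 natrD; ring.
Qed.

Definition euler (R : realType) N (x : R) : R := (1 + N%:R^-1 * x) ^+ N.

Definition euler_exp (R : realType) n N (Y : 'M[R]_n) : 'M[R]_n :=
  (1 + N%:R^-1 *: Y) ^+ N.

Lemma euler_le_expR (R : realType) N (x : R) : 0 <= x ->
  euler N x <= expR x.
Proof.
rewrite /euler => x0; case: N => [|N]; first by rewrite expr0 -expR0 ler_expR.
apply: (@le_trans _ _ (expR (N.+1%:R^-1 * x) ^+ N.+1)).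
  rewrite lerXn2r ?nnegrE ?expR_ge0 ?expR_ge1Dx//.
  by rewrite addr_ge0 ?ler01// mulr_ge0 ?invr_ge0.
by rewrite -expRM_natl mulrA divff ?mul1r// pnatr_eq0.
Qed.

(** [(1 + Y/N) (1 + X/N)] differs from [1 + (Y + X)/N] by [Y X / N^2], so the
    [N]-th powers differ by [O(1/N)]; the power of the product is handled by the
    trace inequality.  The constant is uniform over bounded matrices because the
    recursion applies it to every outcome of the sampling at once. *)
Lemma golden_thompson_euler (R : realType) n (B : R) : 0 <= B ->
  exists2 C, 0 <= C & forall k (Y X : 'M[R]_n), Y^T = Y -> X^T = X ->
    sumnorm Y <= B -> sumnorm X <= B ->
  let N := (2 ^ k)%N in
  \tr (euler_exp N (Y + X)) <=
    \tr (euler_exp N Y * euler_exp N X) + C / N%:R.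
Proof.
move=> B0; set K := 2 * B + B ^+ 2.
have K0 : 0 <= K by rewrite addr_ge0 ?sqr_ge0// mulr_ge0.
exists (n%:R * expR K * B ^+ 2).
  by rewrite !mulr_ge0 ?sqr_ge0 ?expR_ge0.
move=> k Y X sY sX YB XB; set N := (2 ^ k)%N => /=.
have N0 : 0 < N%:R :> R by rewrite ltr0n expn_gt0.
have N1 : 1 <= N%:R :> R by rewrite ler1n expn_gt0.
pose v : R := N%:R^-1.
have v0 : 0 <= v by rewrite invr_ge0 ltW.
have v1 : v <= 1 by rewrite invf_le1.
pose W := v *: (Y + X); pose W' := v *: (Y + X) + v ^+ 2 *: (Y * X).
have YX : sumnorm (Y * X) <= B ^+ 2.
  by rewrite (le_trans (sumnormM _ _))// expr2 ler_pM ?sumnorm_ge0.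
have sumYX : sumnorm (v *: (Y + X)) <= v * (2 * B).
  rewrite sumnormZ ger0_norm// ler_wpM2l// (le_trans (sumnormD _ _))//.
  by rewrite mulr_natl mulr2n lerD.
have vYX : sumnorm (v ^+ 2 *: (Y * X)) <= v ^+ 2 * B ^+ 2.
  by rewrite sumnormZ ger0_norm ?sqr_ge0// ler_wpM2l ?sqr_ge0.
have vv : v ^+ 2 * B ^+ 2 <= v * B ^+ 2.
  by rewrite ler_wpM2r ?sqr_ge0// expr2 ler_piMl.
have HW : sumnorm W <= v * K.
  by apply: (le_trans sumYX); rewrite /K mulrDr lerDl mulr_ge0 ?sqr_ge0.
have HW' : sumnorm W' <= v * K.
  by rewrite (le_trans (sumnormD _ _))// /K mulrDr lerD// (le_trans vYX).
have HWW : sumnorm (W - W') <= v ^+ 2 * B ^+ 2.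
  by rewrite opprD addNKr -scaleN1r sumnormZ normrN1 mul1r.
have D := sumnorm_exp1D_sub N HW HW' HWW.
have E : 1 + W' = (1 + v *: Y) * (1 + v *: X).
  have vvE : (v *: Y) * (v *: X) = v ^+ 2 *: (Y * X).
    by rewrite -[LHS]/(_ *m _) -scalemxAl -scalemxAr scalerA.
  rewrite mulrDl mul1r mulrDr mulr1 vvE /W' scalerDr.
  by rewrite [v *: Y + _]addrC -!addrA.
have GT : \tr ((1 + W') ^+ N) <= \tr (euler_exp N Y * euler_exp N X).
  rewrite E; apply: (mxtraceX_two_power _ _ _).1.
    by rewrite linearD linearZ /= sY trmx1.
  by rewrite linearD linearZ /= sX trmx1.
have T : \tr (euler_exp N (Y + X)) =
   \tr ((1 + W') ^+ N) + \tr ((1 + W) ^+ N - (1 + W') ^+ N).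
  by rewrite raddfB /= addrCA subrr addr0.
rewrite T; apply: lerD => //; apply: (le_trans (ler_mxtrace_sumnorm _)).
apply: (le_trans D).
have EK : (1 + v * K) ^+ N <= expR K by apply: euler_le_expR.
apply: (@le_trans _ _ (n%:R * N%:R * expR K * (v ^+ 2 * B ^+ 2))).
  by rewrite ler_wpM2r ?mulr_ge0 ?sqr_ge0// ler_wpM2l// mulr_ge0// ltW.
rewrite le_eqVlt; apply/orP; left; apply/eqP.
by rewrite /v; field; rewrite gt_eqF.
Qed.

(** * Scalar estimates *)

(** An even power is convex on the whole line, hence above its tangents. *)
Lemma exprn_tangent (R : realFieldType) N (u v : R) : 0 <= v -> ~~ odd N ->
  v ^+ N + N%:R * v ^+ N.-1 * (u - v) <= u ^+ N.
Proof.
move=> v0 oN; case: N oN => [|N] oN; first by rewrite !expr0 mul0r mul0r addr0.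
case: (lerP 0 u) => [u0|u0] /=; last first.
  apply: (@le_trans _ _ 0); last by rewrite exprn_even_ge0.
  have -> : v ^+ N.+1 + N.+1%:R * v ^+ N * (u - v) =
      v ^+ N * (N.+1%:R * u - N%:R * v).
    by rewrite exprS -addn1 natrD; ring.
  rewrite mulr_ge0_le0 ?exprn_ge0// subr_le0.
  by rewrite (@le_trans _ _ 0) ?mulr_ge0// mulr_ge0_le0// ltW.
elim: N {oN} => [|N IH]; first by rewrite !expr1 expr0 !mul1r addrCA subrr addr0.
rewrite [leRHS]exprS; apply: le_trans (ler_wpM2l u0 IH).
rewrite -subr_ge0.
have -> : u * (v ^+ N.+1 + N.+1%:R * v ^+ N * (u - v)) -
    (v ^+ N.+2 + N.+2%:R * v ^+ N.+1 * (u - v)) = N.+1%:R * v ^+ N * (u - v) ^+ 2.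
  by rewrite !exprS -(addn1 N.+1) natrD; ring.
by apply: mulr_ge0 (sqr_ge0 _); rewrite mulr_ge0 ?exprn_ge0.
Qed.

(** In the form ['C(N, k) / N ^ k <= 1 / k! <= 1 / (2 * 3 ^ (k - 2))], this
    compares the tail of the binomial expansion of [(1 + x / N) ^ N] with a
    geometric series of ratio [x / 3]. *)
Lemma leq_bin_expn N i : ('C(N, i.+2) * (2 * 3 ^ i) <= N ^ i.+2)%N.
Proof.
elim: i => [|i IH].
  rewrite expn0 muln1 mulnC (_ : 2 = 2`!)%N// mulnC bin_ffact ffactnS ffactn1.
  by rewrite expnS expn1 leq_mul2l leq_pred orbT.
have H : ('C(N, i.+3) * i.+3 = 'C(N, i.+2) * (N - i.+2))%N.
  by rewrite mulnC mul_bin_left mulnC.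
apply: (@leq_trans ('C(N, i.+3) * i.+3 * (2 * 3 ^ i))).
  by rewrite expnS (mulnCA 2%N) mulnA !leq_mul.
rewrite H mulnAC expnSr; apply: leq_mul => //; exact: leq_subr.
Qed.

Lemma sum_geometric_le (R : realFieldType) k (q : R) : 0 <= q -> q < 1 ->
  \sum_(i < k) q ^+ i <= (1 - q)^-1.
Proof.
move=> q0 q1; have q1' : 0 < 1 - q by rewrite subr_gt0.
rewrite -(ler_pM2l q1') mulfV ?gt_eqF// -opprB mulNr -subrX1.
by rewrite opprB lerBlDr lerDl exprn_ge0.
Qed.

(** The Bernstein bound on the moment generating function.  It holds for each
    finite [N], and on the negative side as well, because it comes from the
    absolute values of the terms of order at least two. *)
Lemma euler_bernstein (R : realType) N (L x : R) : (0 < N)%N -> `|x| <= L -> L < 3 ->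
  euler N x <= 1 + x + (2 * (1 - L / 3))^-1 * x ^+ 2.
Proof.
move=> N0 xL L3; set y := N%:R^-1 * x.
have Nn0 : 0 < N%:R :> R by rewrite ltr0n.
have Ny : N%:R * y = x by rewrite mulVKf// gt_eqF.
rewrite /euler -/y; case: N N0 Nn0 y Ny => // N _ Nn0 y Ny.
rewrite exprDn big_ord_recl /= subn0 expr1n mulr1 bin0 mulr1n -addrA lerD2l.
case: N Nn0 y Ny => [|N] Nn0 y Ny.
  rewrite big_ord1 /= bin1 expr1n mul1r expr1 mulr1n.
  rewrite -Ny mul1r lerDl mulr_ge0 ?sqr_ge0// invr_ge0 mulr_ge0//.
  by rewrite subr_ge0 ler_pdivrMr// mul1r ltW.
rewrite big_ord_recl /= expr1n mul1r /bump /= addn0 bin1 expr1 -mulr_natl Ny lerD2l.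
have L0 : 0 <= L := le_trans (normr_ge0 x) xL.
apply: (@le_trans _ _ (\sum_(i < N.+1) x ^+ 2 / 2 * (L / 3) ^+ i)).
  apply: ler_sum => i _; rewrite /bump /= !add1n expr1n mul1r.
  apply: (le_trans (ler_norm _)); rewrite normrMn normrX -[_ *+ 'C(_, _)]mulr_natr.
  have H : 'C(N.+2, i.+2)%:R * (2 * 3 ^+ i) <= N.+2%:R ^+ i.+2 :> R.
    by rewrite -!natrX -!natrM ler_nat leq_bin_expn.
  rewrite exprMn exprVn.
  have p3 : 0 < 3 ^+ i :> R by rewrite exprn_gt0.
  have -> : x ^+ 2 / 2 * (L ^+ i / 3 ^+ i) = x ^+ 2 * L ^+ i / (2 * 3 ^+ i).
    by field; rewrite gt_eqF.
  rewrite ler_pdivlMr ?mulr_gt0// -mulrA.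
  apply: (le_trans (ler_wpM2l _ H)); first by rewrite exprn_ge0.
  rewrite -[N.+2%:R in leLHS]ger0_norm// -normrX -normrX -normrM -exprMn.
  rewrite [y * _]mulrC Ny normrX exprS exprS -real_normK ?num_real//.
  rewrite expr2 -mulrA.
  by do 2 (rewrite ler_wpM2l//); rewrite lerXn2r ?nnegrE.
rewrite -mulr_sumr.
have q1 : L / 3 < 1 by rewrite ltr_pdivrMr// mul1r.
have q0 : 0 <= L / 3 by rewrite divr_ge0.
rewrite invfM [leRHS]mulrAC [2^-1 * _]mulrC ler_wpM2l ?sum_geometric_le//.
by rewrite divr_ge0 ?sqr_ge0.
Qed.

Lemma euler_ge_expR (R : realType) N (x : R) : (0 < N)%N -> 0 <= x ->
  expR x - expR x * x ^+ 2 / N%:R <= euler N x.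
Proof.
move=> N0 x0; have Nn0 : 0 < N%:R :> R by rewrite ltr0n.
(* With [y := x / N], [1 + y >= exp (y / (1 + y)) >= exp (y - y ^ 2)] *)
set y := N%:R^-1 * x.
have y0 : 0 <= y by rewrite mulr_ge0// invr_ge0 ltW.
have yp : 0 < 1 + y by rewrite ltr_pwDl.
have H : expR (y - y ^+ 2) <= 1 + y.
  apply: (@le_trans _ _ (expR (y / (1 + y)))).
    rewrite ler_expR ler_pdivlMr// -subr_ge0.
    have -> : y - (y - y ^+ 2) * (1 + y) = y ^+ 3 by ring.
    by rewrite exprn_ge0.
  have := expR_ge1Dx (- (y / (1 + y))).
  have -> : 1 - y / (1 + y) = (1 + y)^-1 by field; rewrite gt_eqF.
  by rewrite expRN lef_pV2 ?posrE ?expR_gt0.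
apply: (@le_trans _ _ (expR (y - y ^+ 2) ^+ N)); last first.
  by rewrite /euler -/y lerXn2r ?nnegrE ?expR_ge0// ltW.
rewrite -expRM_natl.
have -> : N%:R * (y - y ^+ 2) = x + (- (x ^+ 2 / N%:R)).
  by rewrite /y; field; rewrite gt_eqF.
rewrite expRD -mulrA -{1}[expR x]mulr1 -mulrBr ler_wpM2l ?expR_ge0//.
exact: expR_ge1Dx.
Qed.

Lemma le_of_le_add_inv_pow2 (R : realType) (u w C : R) : 0 <= C ->
  (forall k, u <= w + C / (2 ^ k.+1)%:R) -> u <= w.
Proof.
move=> C0 H; apply/ler_addgt0Pr => e e0.
set k := Num.truncn (C / e).
have kC : C / e < k.+1%:R by rewrite truncnS_gt.
apply: (le_trans (H k)); rewrite lerD2l ler_pdivrMr ?ltr0n ?expn_gt0//.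
rewrite mulrC -ler_pdivrMr// (le_trans (ltW kC))// ler_nat.
exact/ltnW/ltn_expl.
Qed.

(** * Quadratic forms and frames of eigenvectors *)

(** The real and imaginary parts (second index) of the rows of a unitary matrix
    diagonalizing [Y] are real eigenvectors, as the eigenvalues are real.  They
    need not be orthogonal, but they form a tight frame, and this resolution of
    the identity is all that is needed to diagonalize traces and quadratic
    forms. *)
Lemma sym_eigenframe (R : rcfType) n (Y : 'M[R]_n) : Y^T = Y ->
  exists (lam : 'I_n * bool -> R) (w : 'I_n * bool -> 'cV[R]_n),
    \sum_k w k *m (w k)^T = 1 /\ forall k, Y *m w k = lam k *: w k.
Proof.
move=> sY; pose A := map_mx (real_complex R) Y.
have hA : A \is hermsymmx.
  apply: realsym_hermsym.
    apply/is_hermitianmxP; rewrite expr0 scale1r map_mx_id//.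
    by rewrite map_trmx sY.
  by apply/mxOverP => i j; rewrite mxE; apply/complex_realP; exists (Y i j).
have /hermitian_normalmx/orthomx_spectralP AE := hA.
have Dre := hermitian_spectral_diag_real hA.
have Pu := spectral_unitarymx A; have Pun := spectral_unit A.
set P := spectralmx A in AE Pu Pun; set D := spectral_diag A in AE Dre.
have PA : P *m A = diag_mx D *m P by rewrite [in LHS]AE -mulmxA mulKVmx.
have PP : (map_mx Num.conj P^T) *m P = 1%:M.
  by rewrite -invmx_unitary// mulVmx.
have ReS (I : finType) (F : I -> R[i]) :
    complex.Re (\sum_i F i) = \sum_i complex.Re (F i).
  by apply: (big_morph _ (_ : {morph _ : x y / x + y}) _) => // -[a b] [].
have ImS (I : finType) (F : I -> R[i]) :
    complex.Im (\sum_i F i) = \sum_i complex.Im (F i).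
  by apply: (big_morph _ (_ : {morph _ : x y / x + y}) _) => // -[a b] [].
exists (fun k => complex.Re (D 0 k.1)).
exists (fun k => \col_i
  (if k.2 then complex.Re (P k.1 i) else complex.Im (P k.1 i))).
split.
  (* The real part of [P^* P = 1] *)
  apply/matrixP => i j; have /matrixP/(_ i j) := PP.
  rewrite summxE mxE => /(congr1 (@complex.Re R)); rewrite ReS => E.
  transitivity (complex.Re ((1%:M : 'M[R[i]]_n) i j)); last first.
    by rewrite !mxE; case: (i == j).
  pose v k b := \col_l (if b then complex.Re (P k l) else complex.Im (P k l)).
  rewrite -E -(pair_bigA _ (fun k b => (v k b *m (v k b)^T) i j)) /=.
  apply: eq_bigr => k _.
  rewrite !mxE /= big_bool !mxE !big_ord1 !mxE /=.
  by case: (P k i) => a b; case: (P k j) => a' b' /=; rewrite mulNr opprK.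
move=> [k b]; apply/matrixP => i j; rewrite !mxE /=.
(* The real or imaginary part of row [k] of [P A = D P] *)
have /matrixP/(_ k i) := PA; rewrite mul_diag_mx !mxE.
have /mxOverP/(_ 0 k)/complex_realP[d dE] := Dre.
rewrite dE /= => E; case: b.
  move/(congr1 (@complex.Re R)): E; rewrite ReS.
  case: (P k i) => u v /=; rewrite mul0r subr0 => <-.
  apply: eq_bigr => l _; rewrite !mxE -{1}sY mxE mulrC.
  by case: (P k l) => u' v' /=; rewrite mulr0 subr0.
move/(congr1 (@complex.Im R)): E; rewrite ImS.
case: (P k i) => u v /=; rewrite mul0r addr0 => <-.
apply: eq_bigr => l _; rewrite !mxE -{1}sY mxE mulrC.
by case: (P k l) => u' v' /=; rewrite mulr0 add0r.
Qed.

Definition qform (R : realType) n (Q : 'M[R]_n) (x : 'cV[R]_n) : R :=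
  \tr (Q *m (x *m x^T)).

Lemma qformE (R : realType) n (Q : 'M[R]_n) x : qform Q x = (x^T *m (Q *m x)) 0 0.
Proof. by rewrite /qform mulmxA mxtrace_mulC /mxtrace big_ord1. Qed.

Lemma qformD (R : realType) n (Q Q' : 'M[R]_n) x :
  qform (Q + Q') x = qform Q x + qform Q' x.
Proof. by rewrite /qform mulmxDl mxtraceD. Qed.

Lemma qformZ (R : realType) n a (Q : 'M[R]_n) x : qform (a *: Q) x = a * qform Q x.
Proof. by rewrite /qform -scalemxAl mxtraceZ. Qed.

Lemma qformN (R : realType) n (Q : 'M[R]_n) x : qform (- Q) x = - qform Q x.
Proof. by rewrite -scaleN1r qformZ mulN1r. Qed.

Lemma qform_sum (R : realType) n (I : finType) (Q : I -> 'M[R]_n) x :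
  qform (\sum_i Q i) x = \sum_i qform (Q i) x.
Proof. by rewrite /qform mulmx_suml raddf_sum. Qed.

Lemma qform1 (R : realType) n (x : 'cV[R]_n) : qform 1 x = \sum_i x i 0 ^+ 2.
Proof.
rewrite /qform mul1mx; apply: eq_bigr => i _.
by rewrite mxE big_ord1 mxE expr2.
Qed.

Lemma qform1_ge0 (R : realType) n (x : 'cV[R]_n) : 0 <= qform 1 x.
Proof. by rewrite qform1 sumr_ge0// => i _; apply: sqr_ge0. Qed.

Lemma qform_gram (R : realType) m n (A : 'M[R]_(m, n)) x :
  qform (A *m A^T) x = qform 1 (A^T *m x).
Proof.
rewrite /qform mul1mx trmx_mul trmxK mulmxA -mulmxA -mulmxA mxtrace_mulC.
by rewrite !mulmxA.
Qed.

Lemma qform_rank1 (R : realType) n (u x : 'cV[R]_n) :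
  qform (u *m u^T) x = (u^T *m x) 0 0 ^+ 2.
Proof. by rewrite qform_gram qform1 big_ord1. Qed.

Lemma qformZr (R : realType) n (Q : 'M[R]_n) a x :
  qform Q (a *: x) = a ^+ 2 * qform Q x.
Proof.
by rewrite /qform linearZ /= -scalemxAl -!scalemxAr scalerA mxtraceZ expr2.
Qed.

Lemma qform1_eq0 (R : realType) n (x : 'cV[R]_n) : qform 1 x = 0 -> x = 0.
Proof.
rewrite qform1 => /eqP; rewrite psumr_eq0 => [/allP x0|i _]; last exact: sqr_ge0.
apply/matrixP => i j; rewrite ord1 mxE; apply/eqP; rewrite -sqrf_eq0.
by apply: x0; rewrite mem_index_enum.
Qed.

Lemma qform1_gt0 (R : realType) n (x : 'cV[R]_n) : x != 0 -> 0 < qform 1 x.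
Proof.
move=> x0; rewrite lt_def qform1_ge0 andbT.
by apply: contra_neq x0; apply: qform1_eq0.
Qed.

Definition psd (R : realType) n (Q : 'M[R]_n) : Prop := forall x, 0 <= qform Q x.

Lemma psdD (R : realType) n (Q Q' : 'M[R]_n) : psd Q -> psd Q' -> psd (Q + Q').
Proof. by move=> Q0 Q'0 x; rewrite qformD addr_ge0. Qed.

Lemma psdZ (R : realType) n a (Q : 'M[R]_n) : 0 <= a -> psd Q -> psd (a *: Q).
Proof. by move=> a0 Q0 x; rewrite qformZ mulr_ge0. Qed.

Lemma qform_eigen (R : realType) n (F : 'M[R]_n) f w : F *m w = f *: w ->
  qform F w = f * qform 1 w.
Proof. by move=> Fw; rewrite /qform mulmxA Fw mul1mx -scalemxAl mxtraceZ. Qed.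

Section Frame.
Variables (R : realType) (n : nat) (K : finType) (w : K -> 'cV[R]_n).
Hypothesis w_frame : \sum_k w k *m (w k)^T = 1.

Lemma frame_mxtrace (F Q : 'M[R]_n) (f : K -> R) :
  (forall k, F *m w k = f k *: w k) -> \tr (F * Q) = \sum_k f k * qform Q (w k).
Proof.
move=> Fw; rewrite -[F]mulr1 -w_frame mxtrace_mulC -[_ * _]/(_ *m _).
rewrite !mulmx_sumr raddf_sum; apply: eq_bigr => k _ /=.
by rewrite /qform mulmxA Fw -scalemxAl -scalemxAr mxtraceZ.
Qed.

Lemma frame_qform (F : 'M[R]_n) (f : K -> R) x :
  (forall k, F *m w k = f k *: w k) ->
  qform F x = \sum_k f k * qform (x *m x^T) (w k).
Proof. exact: frame_mxtrace. Qed.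

Lemma frame_parseval x : qform 1 x = \sum_k qform (x *m x^T) (w k).
Proof.
rewrite (@frame_qform _ (fun=> 1)) => [|k]; last by rewrite mul1mx scale1r.
by apply: eq_bigr => k _; rewrite mul1r.
Qed.

End Frame.

Lemma psd_mxtrace (R : realType) n (Q : 'M[R]_n) : psd Q -> 0 <= \tr Q.
Proof.
move=> Q0; have [_ [w [w1 _]]] := @sym_eigenframe R n 0 (trmx0 _ _ _).
rewrite -[Q]mul1r (@frame_mxtrace _ _ _ w w1 _ _ (fun=> 1)) => [|k].
  by rewrite sumr_ge0// => k _; rewrite mul1r.
by rewrite mul1mx scale1r.
Qed.

Lemma euler_exp_eigen (R : realType) n N (Y : 'M[R]_n) lam (w : 'cV[R]_n) :
  Y *m w = lam *: w -> euler_exp N Y *m w = euler N lam *: w.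
Proof.
move=> Yw; rewrite /euler_exp /euler.
have bw : (1 + N%:R^-1 *: Y) *m w = (1 + N%:R^-1 * lam) *: w.
  by rewrite mulmxDl mul1mx -scalemxAl Yw scalerA scalerDl scale1r.
move: (1 + _ *: Y) (1 + _ * _) bw => b c bw.
elim: N => [|k IH]; first by rewrite !expr0 mul1mx scale1r.
by rewrite exprSr -[_ * b]/(_ *m b) -mulmxA bw -scalemxAr IH scalerA -exprS.
Qed.

(** A frame may contain null vectors, about whose eigenvalue nothing can be
    said. *)
Lemma eigen_bound (R : realType) n (Y : 'M[R]_n) lam (w : 'cV[R]_n) L :
  (forall x, `|qform Y x| <= L * qform 1 x) -> Y *m w = lam *: w ->
  w = 0 \/ `|lam| <= L.
Proof.
move=> YL Yw; have [->|w0] := eqVneq w 0; [by left|right].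
have := YL w; rewrite (qform_eigen Yw) normrM (ger0_norm (qform1_ge0 _)).
by rewrite ler_pM2r// qform1_gt0.
Qed.

Lemma euler_exp_bernstein (R : realType) n N (X : 'M[R]_n) L x :
  X^T = X -> (0 < N)%N -> L < 3 ->
  (forall x, `|qform X x| <= L * qform 1 x) ->
  qform (euler_exp N X) x <=
  qform (1 + X + (2 * (1 - L / 3))^-1 *: X ^+ 2) x.
Proof.
move=> sX N0 L3 XL; have [lam [w [w1 Xw]]] := sym_eigenframe sX.
rewrite (frame_qform w1 _ (fun k => euler_exp_eigen N (Xw k))).
set g := _^-1.
rewrite (frame_qform (f := fun k => 1 + lam k + g * lam k ^+ 2) w1) => [|k]; last first.
  rewrite !mulmxDl mul1mx Xw -scalemxAl expr2 -[X * X]/(X *m X) -mulmxA Xw.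
  by rewrite -scalemxAr Xw !scalerA -mulrA -expr2 !scalerDl scale1r.
apply: ler_sum => k _.
have [->|lamL] := eigen_bound XL (Xw k).
  by rewrite /qform mul0mx mulmx0 mxtrace0 !mulr0.
rewrite ler_wpM2r ?euler_bernstein//.
by rewrite qform_rank1 sqr_ge0.
Qed.

(** The exponential without its affine part; it is removed so that the function
    is nonnegative and its tangent at [0] is horizontal. *)
Definition psi (R : realType) N (x : R) : R := euler N x - 1 - x.

Definition psi_mx (R : realType) n N (Y : 'M[R]_n) : 'M[R]_n :=
  euler_exp N Y - 1 - Y.

Lemma psi_mx_eigen (R : realType) n N (Y : 'M[R]_n) lam (w : 'cV[R]_n) :
  Y *m w = lam *: w -> psi_mx N Y *m w = psi N lam *: w.
Proof.
move=> Yw; rewrite /psi_mx !mulmxBl mul1mx (euler_exp_eigen N Yw) Yw.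
by rewrite /psi !scalerBl scale1r.
Qed.

Lemma psi_tangent (R : realType) N (a x : R) : (0 < N)%N -> ~~ odd N -> 0 <= a ->
  psi N a + ((1 + N%:R^-1 * a) ^+ N.-1 - 1) * (x - a) <= psi N x.
Proof.
move=> N0 oN a0; have Nn0 : N%:R != 0 :> R by rewrite pnatr_eq0 -lt0n.
have v0 : 0 <= 1 + N%:R^-1 * a by rewrite addr_ge0// mulr_ge0// invr_ge0.
have := exprn_tangent (1 + N%:R^-1 * x) v0 oN.
rewrite /psi /euler; set V := _ ^+ N.-1.
have -> : N%:R * V * (1 + N%:R^-1 * x - (1 + N%:R^-1 * a)) = V * (x - a).
  by field.
lra.
Qed.

Lemma psi_ge0 (R : realType) N (x : R) : (0 < N)%N -> ~~ odd N -> 0 <= psi N x.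
Proof.
move=> N0 oN; have := psi_tangent x N0 oN (lexx 0).
rewrite mulr0 addr0 expr1n subrr mul0r addr0.
by rewrite /psi /euler mulr0 addr0 expr1n subrr subr0.
Qed.

(** [psi_mx N Y] is positive semidefinite because [psi N] is nonnegative, and the
    trace of a product of two such matrices is nonnegative. *)
Lemma mxtrace_psi_mul_ge0 (R : realType) n N (Y Q : 'M[R]_n) :
  (0 < N)%N -> ~~ odd N -> Y^T = Y -> psd Q -> 0 <= \tr (psi_mx N Y * Q).
Proof.
move=> N0 oN sY Q0; have [lam [w [w1 Yw]]] := sym_eigenframe sY.
rewrite (frame_mxtrace w1 _ (fun k => psi_mx_eigen N (Yw k))).
by rewrite sumr_ge0// => k _; rewrite mulr_ge0 ?psi_ge0.
Qed.

Lemma qform_cauchy_schwarz (R : realType) n (u x : 'cV[R]_n) :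
  (u^T *m x) 0 0 ^+ 2 <= qform 1 u * qform 1 x.
Proof.
have [->|u0] := eqVneq u 0.
  by rewrite trmx0 mul0mx mxE expr0n /qform mul0mx mulmx0 mxtrace0 mul0r.
set c := (u^T *m x) 0 0.
have qu : 0 < qform 1 u.
  by exact: qform1_gt0.
have E a b : qform 1 (a *: x - b *: u) =
    a ^+ 2 * qform 1 x - 2 * a * b * c + b ^+ 2 * qform 1 u.
  rewrite !qform1 /c mxE !mulr_sumr -sumrB -big_split.
  by apply: eq_bigr => i _ /=; rewrite !mxE; ring.
(* [|u|^2] times the component of [x] orthogonal to [u] *)
have := qform1_ge0 (qform 1 u *: x - c *: u); rewrite E.
have -> : qform 1 u ^+ 2 * qform 1 x - 2 * qform 1 u * c * c + c ^+ 2 * qform 1 u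
   = qform 1 u * (qform 1 u * qform 1 x - c ^+ 2) by ring.
by rewrite pmulr_rge0// subr_ge0.
Qed.

Lemma psd_sub_rank1 (R : realType) n (x : 'cV[R]_n) :
  qform 1 x = 1 -> psd (1 - x *m x^T).
Proof.
move=> x1 y; rewrite qformD qformN qform_rank1 subr_ge0.
by rewrite (le_trans (qform_cauchy_schwarz _ _))// x1 mul1r.
Qed.

(** Jensen's inequality: the weights [qform (x *m x^T) (w k)] sum to 1 and [psi]
    lies above its tangent at [a], whose slope is nonnegative. *)
Lemma mxtrace_psi_ge (R : realType) n N (Y : 'M[R]_n) x a :
  (0 < N)%N -> ~~ odd N -> Y^T = Y ->
  0 <= a -> qform 1 x = 1 -> a <= qform Y x -> psi N a <= \tr (psi_mx N Y).
Proof.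
move=> N0 oN sY a0 x1 Yx.
apply: (@le_trans _ _ (qform (psi_mx N Y) x)); last first.
  have := mxtrace_psi_mul_ge0 N0 oN sY (psd_sub_rank1 x1).
  by rewrite mulrBr mulr1 raddfB /= subr_ge0.
have [lam [w [w1 Yw]]] := sym_eigenframe sY.
rewrite (frame_qform w1 _ (fun k => psi_mx_eigen N (Yw k))).
set d := (1 + N%:R^-1 * a) ^+ N.-1 - 1.
have d0 : 0 <= d.
  by rewrite subr_ge0 exprn_ege1// lerDl mulr_ge0// invr_ge0.
apply: (@le_trans _ _ (\sum_k (psi N a + d * (lam k - a)) *
                              qform (x *m x^T) (w k))); last first.
  apply: ler_sum => k _; rewrite ler_wpM2r ?psi_tangent//.
  by rewrite qform_rank1 sqr_ge0.
have -> : \sum_k (psi N a + d * (lam k - a)) * qform (x *m x^T) (w k) =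
   psi N a * qform 1 x + d * (qform Y x - a * qform 1 x).
  rewrite (frame_parseval w1) (frame_qform w1 _ Yw).
  rewrite !mulr_sumr -sumrB mulr_sumr -big_split.
  by apply: eq_bigr => k _ /=; ring.
by rewrite x1 !mulr1 lerDl mulr_ge0// subr_ge0.
Qed.

(** * The Bernstein inequality with intrinsic dimension *)

Section IidSum.
Variables (R : realType) (d : nat) (I : finType) (p : I -> R) (X : I -> 'M[R]_d).

(** Expectation of [F] at a sum of [k] independent copies of [X], whose index is
    distributed according to [p]. *)
Definition iid_mean k (F : 'M[R]_d -> R) : R :=
  \sum_(s : {ffun 'I_k -> I}) (\prod_j p (s j)) * F (\sum_j X (s j)).

(** Conditioning on all the indices but one. *)
Lemma iid_meanS k F :
  iid_mean k.+1 F = iid_mean k (fun Y => \sum_i p i * F (Y + X i)).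
Proof.
rewrite /iid_mean.
pose ext (u : {ffun 'I_k -> I} * I) : {ffun 'I_k.+1 -> I} :=
  [ffun j => if unlift ord0 j is Some l then u.1 l else u.2].
pose res (s : {ffun 'I_k.+1 -> I}) : {ffun 'I_k -> I} * I :=
  ([ffun l => s (lift ord0 l)], s ord0).
have extK : cancel ext res.
  move=> [s i]; rewrite /res /ext ffunE unlift_none /=; congr (_, _).
  by apply/ffunP => l; rewrite !ffunE liftK.
have resK : cancel res ext.
  move=> s; apply/ffunP => j; rewrite !ffunE; case: unliftP => [l ->|->] //=.
  by rewrite ffunE.
rewrite (reindex ext) /=; last by exists res => ? _; [exact: extK|exact: resK].
transitivity (\sum_(s : {ffun 'I_k -> I}) \sum_i
    (\prod_j p (s j)) * (p i * F (\sum_j X (s j) + X i))); last first.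
  by apply: eq_bigr => s _; rewrite mulr_sumr.
rewrite pair_big /=; apply: eq_bigr => -[s i] _ /=.
rewrite !big_ord_recl !ffunE unlift_none /= mulrCA mulrA addrC.
by congr (_ * _ * F (_ + _)); apply: eq_bigr => l _; rewrite ffunE liftK.
Qed.

Hypothesis p_ge0 : forall i, 0 <= p i.
Hypothesis p_sum1 : \sum_i p i = 1.
Hypothesis X_sym : forall i, (X i)^T = X i.
Hypothesis X_mean0 : \sum_i p i *: X i = 0.

Lemma iid_mean_le k F G :
  (forall s : {ffun 'I_k -> I}, F (\sum_j X (s j)) <= G (\sum_j X (s j))) ->
  iid_mean k F <= iid_mean k G.
Proof.
by move=> FG; apply: ler_sum => s _; rewrite ler_wpM2l// prodr_ge0.
Qed.

Lemma iid_mean1 k : iid_mean k (fun=> 1) = 1.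
Proof.
elim: k => [|k IH].
  rewrite /iid_mean (big_pred1 (ffun0 (card_ord 0))) ?big_ord0 ?mulr1//.
  by move=> s; apply/esym/eqP/ffunP => -[].
rewrite iid_meanS -[RHS]IH; apply: eq_bigr => s _.
by rewrite -mulr_suml p_sum1 mul1r.
Qed.

Lemma iid_mean_affine k F G a b :
  iid_mean k (fun Y => a * F Y + b + G Y) = a * iid_mean k F + b + iid_mean k G.
Proof.
rewrite -[X in _ + X + _]mulr1 -[in RHS](iid_mean1 k).
rewrite /iid_mean !mulr_sumr -!big_split.
by apply: eq_bigr => s _ /=; ring.
Qed.

(** Linear functionals of a centered sum have mean zero.  This is why the linear
    term of the exponential is absent from the recursion below. *)
Lemma iid_mean_mxtrace k (D : 'M[R]_d) : iid_mean k (fun Y => \tr (Y * D)) = 0.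
Proof.
elim: k => [|k IH].
  rewrite /iid_mean big1// => s _.
  by rewrite [X in \tr (X * _)]big_ord0 mul0r mxtrace0 mulr0.
rewrite iid_meanS -[RHS]IH; apply: eq_bigr => s _; congr (_ * _).
set Y := \sum_j X (s j).
transitivity (\tr ((Y + \sum_i p i *: X i) * D)); last by rewrite X_mean0 addr0.
have -> : Y + \sum_i p i *: X i = \sum_i p i *: (Y + X i).
  rewrite -[in LHS](scale1r Y) -p_sum1 scaler_suml -big_split /=.
  by apply: eq_bigr => i _; rewrite scalerDr.
rewrite -[_ * D]/(_ *m D) mulmx_suml raddf_sum; apply: eq_bigr => i _ /=.
by rewrite -scalemxAl mxtraceZ.
Qed.

Variables (L v s : R) (V : 'M[R]_d).
Hypothesis L_lt3 : L < 3.
Hypothesis X_le : forall i x, `|qform (X i) x| <= L * qform 1 x.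
Hypothesis var_le : psd (V - \sum_i p i *: X i ^+ 2).
Hypothesis V_le : psd (v *: (1 : 'M[R]_d) - V).
Hypothesis trV_le : \tr V <= s * v.

Let g : R := (2 * (1 - L / 3))^-1.
Let r : R := g * v.

Let g_ge0 : 0 <= g.
Proof. by rewrite invr_ge0 mulr_ge0// subr_ge0 ler_pdivrMr// mul1r ltW. Qed.

Definition mgf_excess N : 'M[R]_d := \sum_i p i *: euler_exp N (X i) - 1.

(** Averaging the Bernstein bound over [i]: the first-order term is killed by the
    centering and the second-order one is dominated by [V]. *)
Lemma mgf_excess_le N : (0 < N)%N -> psd (g *: V - mgf_excess N).
Proof.
move=> N0 x; rewrite qformD qformN qformD qformN qformZ qform_sum subr_ge0.
have := var_le x; rewrite qformD qformN subr_ge0 => /(ler_wpM2l g_ge0).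
apply: le_trans.
rewrite lerBlDr qform_sum mulr_sumr.
have m0 : \sum_i p i * qform (X i) x = 0.
  have := congr1 (fun Q => qform Q x) X_mean0.
  rewrite /= qform_sum /qform mul0mx mxtrace0 => h; rewrite -[RHS]h.
  by apply: eq_bigr => i _; rewrite -scalemxAl mxtraceZ.
rewrite -[X in _ + X]mul1r -p_sum1 mulr_suml -[X in X + _]addr0.
rewrite -[X in _ + X + _]m0 -!big_split /=.
apply: ler_sum => i _; rewrite !qformZ.
have := euler_exp_bernstein x (X_sym i) N0 L_lt3 (@X_le i).
rewrite !qformD qformZ -/g => /(ler_wpM2l (p_ge0 i)) h.
by apply: le_trans h _; rewrite le_eqVlt; apply/orP; left; apply/eqP; ring.
Qed.

(** One more summand.  The Golden-Thompson inequality separates [X i] from [Y];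
    with [euler_exp N Y = psi_mx N Y + 1 + Y], the product with [mgf_excess N]
    contributes [r * \tr (psi_mx N Y)], [s * r], and a term linear in [Y]. *)
Lemma mean_psi_step N C Y : (0 < N)%N -> ~~ odd N -> Y^T = Y ->
  (forall i, \tr (euler_exp N (Y + X i)) <=
    \tr (euler_exp N Y * euler_exp N (X i)) + C) ->
  \sum_i p i * \tr (psi_mx N (Y + X i)) <=
  (1 + r) * \tr (psi_mx N Y) + (s * r + C) + \tr (Y * mgf_excess N).
Proof.
move=> N0 oN sY GT; set D := mgf_excess N.
have EY : euler_exp N Y = psi_mx N Y + 1 + Y by rewrite /psi_mx addrAC subrK subrK.
have trD : \tr D <= s * r.
  have := psd_mxtrace (mgf_excess_le N0).
  rewrite raddfB /= mxtraceZ subr_ge0 -/D => h; apply: le_trans h _.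
  by rewrite /r mulrCA ler_wpM2l.
have psiD : \tr (psi_mx N Y * D) <= r * \tr (psi_mx N Y).
  have rD : psd (r *: (1 : 'M[R]_d) - D).
    have -> : r *: (1 : 'M[R]_d) - D = g *: (v *: (1 : 'M[R]_d) - V) + (g *: V - D).
      by rewrite scalerBr scalerA addrA subrK.
    by apply: psdD; [exact: psdZ|exact: mgf_excess_le].
  have := mxtrace_psi_mul_ge0 N0 oN sY rD.
  rewrite mulrBr raddfB /= subr_ge0 => h; apply: le_trans h _.
  by rewrite -[X in \tr X <= _]/(_ *m (_ *: 1%:M)) -scalemxAr mulmx1 mxtraceZ.
have H i : p i * \tr (psi_mx N (Y + X i)) <=
   p i * \tr (euler_exp N Y * euler_exp N (X i)) +
   p i * (C - \tr (1 + Y : 'M[R]_d)) - \tr (p i *: X i).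
  rewrite mxtraceZ -mulrDr -mulrBr ler_wpM2l//.
  by have := GT i; rewrite /psi_mx !raddfB /= !raddfD /=; lra.
apply: (le_trans (ler_sum _ (fun i _ => H i))).
rewrite sumrB big_split /= -mulr_suml p_sum1 mul1r.
have -> : \sum_i \tr (p i *: X i) = 0.
  by rewrite -raddf_sum /= X_mean0 mxtrace0.
have -> : \sum_i p i * \tr (euler_exp N Y * euler_exp N (X i)) =
    \tr (euler_exp N Y * (1 + D)).
  rewrite /D /mgf_excess addrCA subrr addr0 -[_ * \sum_i _]/(_ *m _).
  rewrite mulmx_sumr raddf_sum.
  by apply: eq_bigr => i _ /=; rewrite -scalemxAr mxtraceZ.
have split (S Z D' : 'M[R]_d) : \tr ((S + 1 + Z) * (1 + D')) =
    \tr S + \tr (1 + Z) + \tr (S * D') + \tr D' + \tr (Z * D').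
  by rewrite mulrDr mulr1 !mulrDl mul1r !mxtraceD; ring.
by rewrite EY split; lra.
Qed.

Hypothesis v_ge0 : 0 <= v.

Lemma iid_mean_psi c : exists2 C, 0 <= C & forall k, let N := (2 ^ k.+1)%N in
  iid_mean c (fun Y => \tr (psi_mx N Y)) <= s * ((1 + r) ^+ c - 1) + C / N%:R.
Proof.
(* Every partial sum of at most [c] terms has norm at most [c * b] *)
set b := \sum_i sumnorm (X i).
have Xb i : sumnorm (X i) <= b.
  by rewrite /b (bigD1 i)//= lerDl sumr_ge0// => j _; apply: sumnorm_ge0.
have b0 : 0 <= b by rewrite sumr_ge0// => i _; apply: sumnorm_ge0.
have [C C0 GT] := @golden_thompson_euler R d (c.+1%:R * b) (mulr_ge0 (ler0n _ _) b0).
have r0 : 0 <= r by rewrite mulr_ge0.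
exists (c%:R * (1 + r) ^+ c * C).
  by rewrite !mulr_ge0 ?exprn_ge0 ?addr_ge0.
move=> k /=; set N := (2 ^ k.+1)%N.
have N0 : (0 < N)%N by rewrite expn_gt0.
have oN : ~~ odd N by rewrite /N expnS oddM.
set e := C / N%:R.
have e0 : 0 <= e by rewrite divr_ge0.
suff H j : (j <= c)%N -> iid_mean j (fun Y => \tr (psi_mx N Y)) <=
    s * ((1 + r) ^+ j - 1) + j%:R * (1 + r) ^+ j * e.
  by rewrite -[_ * C / _]mulrA; exact: (H c (leqnn c)).
elim: j => [_|j IH jc].
  rewrite expr0 subrr mulr0 mul0r mul0r addr0 /iid_mean.
  rewrite big1// => u _; rewrite [X in psi_mx _ X]big_ord0 /psi_mx /euler_exp.
  by rewrite scaler0 addr0 expr1n subrr subr0 mxtrace0 mulr0.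
rewrite iid_meanS.
apply: (@le_trans _ _ (iid_mean j (fun Y =>
    (1 + r) * \tr (psi_mx N Y) + (s * r + e) + \tr (Y * mgf_excess N)))).
  apply: iid_mean_le => u.
  have sY : (\sum_j0 X (u j0))^T = \sum_j0 X (u j0).
    by rewrite raddf_sum; apply: eq_bigr => l _; rewrite /= X_sym.
  apply: mean_psi_step => // i; apply: GT => //.
    apply: (le_trans (sumnorm_sum (fun l => Xb (u l)))).
    by rewrite card_ord ler_wpM2r// ler_nat leqW// ltnW.
  by apply: le_trans (Xb i) _; rewrite ler_peMl// ler1n.
rewrite iid_mean_affine iid_mean_mxtrace addr0.
have r1 : 0 <= 1 + r by rewrite addr_ge0.
apply: (@le_trans _ _ ((1 + r) * (s * ((1 + r) ^+ j - 1) +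
                                  j%:R * (1 + r) ^+ j * e) + (s * r + e))).
  by rewrite lerD2r ler_wpM2l// IH// ltnW.
rewrite exprS -addn1 natrD.
have : 1 <= (1 + r) * (1 + r) ^+ j by rewrite -exprS exprn_ege1// lerDl.
move/(ler_wpM2r e0); rewrite mul1r => h.
rewrite -subr_ge0.
have -> : s * ((1 + r) * (1 + r) ^+ j - 1) + (j%:R + 1) * ((1 + r) * (1 + r) ^+ j) * e -
   ((1 + r) * (s * ((1 + r) ^+ j - 1) + j%:R * (1 + r) ^+ j * e) + (s * r + e)) =
   (1 + r) * (1 + r) ^+ j * e - e by ring.
by rewrite subr_ge0.
Qed.

Definition iid_prob c (E : 'M[R]_d -> Prop) : R := iid_mean c (fun Y => `[< E Y >]%:R).

(** Markov's inequality for the nonnegative function [psi], followed by the limit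
    [N -> oo].  The exponential parameter of the Laplace transform method is
    absorbed in the scale of [X]. *)
Theorem bernstein_intdim c a : 0 <= s -> 0 <= a ->
  iid_prob c (fun Y => exists2 x, qform 1 x = 1 & a <= qform Y x) *
    (expR a - 1 - a) <= s * (expR (c%:R * r) - 1).
Proof.
move=> s0 a0; set E := fun Y => _; set q := iid_prob c E.
have r0 : 0 <= r by rewrite mulr_ge0.
have q0 : 0 <= q by apply: sumr_ge0 => u _; rewrite mulr_ge0 ?prodr_ge0.
have [C C0 HC] := iid_mean_psi c.
apply: (@le_of_le_add_inv_pow2 _ _ _ (C + q * (expR a * a ^+ 2))).
  by rewrite addr_ge0// mulr_ge0// mulr_ge0 ?expR_ge0 ?sqr_ge0.
move=> k; have {HC} := HC k => /=; set N := (2 ^ k.+1)%N.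
have N0 : (0 < N)%N by rewrite expn_gt0.
have oN : ~~ odd N by rewrite /N expnS oddM.
have markov : q * psi N a <= iid_mean c (fun Y => \tr (psi_mx N Y)).
  rewrite mulr_suml; apply: ler_sum => u _; rewrite -mulrA ler_wpM2l ?prodr_ge0//.
  set Y := \sum_j X (u j).
  have sY : Y^T = Y by rewrite raddf_sum; apply: eq_bigr => l _; rewrite /= X_sym.
  case: asboolP => [[x x1 ax]|_].
    by rewrite mul1r (mxtrace_psi_ge N0 oN sY a0 x1 ax).
  rewrite mul0r -[psi_mx N Y]mulr1; apply: mxtrace_psi_mul_ge0 => // x.
  exact: qform1_ge0.
have pow_le : (1 + r) ^+ c <= expR (c%:R * r).
  by rewrite expRM_natl lerXn2r ?nnegrE ?expR_ge0 ?expR_ge1Dx// addr_ge0.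
move=> HC.
have H1 := le_trans markov HC.
have H2 : s * ((1 + r) ^+ c - 1) <= s * (expR (c%:R * r) - 1).
  by rewrite ler_wpM2l// lerD2r.
have H3 : q * (expR a - 1 - a - expR a * a ^+ 2 / N%:R) <= q * psi N a.
  by rewrite ler_wpM2l//; have := euler_ge_expR N0 a0; rewrite /psi; lra.
rewrite mulrDl.
have -> : q * (expR a * a ^+ 2) / N%:R = q * (expR a * a ^+ 2 / N%:R).
  by rewrite -mulrA.
move: H3; rewrite mulrBr; lra.
Qed.

End IidSum.

(** * Spectral and Frobenius norms *)

Lemma vnorm2E (R : realType) n (x : 'cV[R]_n) : vnorm2 x = Num.sqrt (qform 1 x).
Proof. by rewrite /vnorm2 qform1. Qed.

Lemma sqr_vnorm2 (R : realType) n (x : 'cV[R]_n) : vnorm2 x ^+ 2 = qform 1 x.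
Proof. by rewrite vnorm2E sqr_sqrtr ?qform1_ge0. Qed.

Lemma sqr_frobenius_norm (R : realType) m n (A : 'M[R]_(m, n)) :
  frobenius_norm A ^+ 2 = \sum_j qform 1 (col j A).
Proof.
rewrite sqr_sqrtr; last by do 2 (rewrite sumr_ge0// => ? _); apply: sqr_ge0.
rewrite exchange_big; apply: eq_bigr => j _; rewrite qform1.
by apply: eq_bigr => i _; rewrite mxE.
Qed.

Lemma qform1_mulmx_le_frobenius (R : realType) m n (A : 'M[R]_(m, n)) x :
  qform 1 (A *m x) <= frobenius_norm A ^+ 2 * qform 1 x.
Proof.
rewrite sqr_sqrtr; last by do 2 (rewrite sumr_ge0// => ? _); apply: sqr_ge0.
rewrite qform1 mulr_suml; apply: ler_sum => i _.
have -> : (A *m x) i 0 = ((row i A)^T^T *m x) 0 0.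
  by rewrite trmxK !mxE; apply: eq_bigr => j _; rewrite !mxE.
apply: le_trans (qform_cauchy_schwarz _ _) _.
rewrite (qform1 (row i A)^T) le_eqVlt; apply/orP; left; apply/eqP; congr (_ * _).
by apply: eq_bigr => j _; rewrite !mxE.
Qed.

Lemma vnorm20 (R : realType) n : vnorm2 (0 : 'cV[R]_n) = 0.
Proof. by rewrite vnorm2E /qform mul0mx mulmx0 mxtrace0 sqrtr0. Qed.

Lemma vnorm2_mulmx_le (R : realType) m n (A : 'M[R]_(m, n)) x :
  vnorm2 x <= 1 -> vnorm2 (A *m x) <= spectral_norm A.
Proof.
move=> x1; apply: ub_le_sup; last by exists x.
exists (frobenius_norm A) => _ [z /= z1 <-].
rewrite -(ler_pXn2r (n := 2)) ?nnegrE ?sqrtr_ge0// sqr_vnorm2.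
apply: le_trans (qform1_mulmx_le_frobenius _ _) _.
rewrite ler_piMr ?sqr_ge0// -sqr_vnorm2.
by rewrite expr_le1// sqrtr_ge0.
Qed.

Lemma spectral_norm_ge0 (R : realType) m n (A : 'M[R]_(m, n)) : 0 <= spectral_norm A.
Proof.
have := @vnorm2_mulmx_le R m n A 0; rewrite mulmx0 !vnorm20.
by apply; rewrite ler01.
Qed.

Lemma spectral_norm_le (R : realType) m n (A : 'M[R]_(m, n)) b : 0 <= b ->
  (forall x, qform 1 (A *m x) <= b ^+ 2 * qform 1 x) -> spectral_norm A <= b.
Proof.
move=> b0 Ab; apply: ge_sup.
  by exists (vnorm2 (A *m 0)), 0 => //=; rewrite vnorm20.
move=> _ [x /= x1 <-].
rewrite -(ler_pXn2r (n := 2)) ?nnegrE ?sqrtr_ge0// sqr_vnorm2.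
apply: le_trans (Ab x) _; rewrite ler_piMr ?sqr_ge0// -sqr_vnorm2.
by rewrite expr_le1// sqrtr_ge0.
Qed.

Lemma qform1_mulmx_le (R : realType) m n (A : 'M[R]_(m, n)) x :
  qform 1 (A *m x) <= spectral_norm A ^+ 2 * qform 1 x.
Proof.
have [->|x0] := eqVneq x 0.
  by rewrite mulmx0 /qform !mul0mx !mulmx0 !mxtrace0 mulr0.
have qx : 0 < qform 1 x.
  by exact: qform1_gt0.
have vx : 0 < vnorm2 x by rewrite vnorm2E sqrtr_gt0.
set y := (vnorm2 x)^-1 *: x.
have y1 : vnorm2 y <= 1.
  by rewrite vnorm2E qformZr exprVn sqr_vnorm2 mulVf ?gt_eqF// sqrtr1.
have : vnorm2 (A *m y) <= spectral_norm A by exact: vnorm2_mulmx_le.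
rewrite -(ler_pXn2r (n := 2)) ?nnegrE ?sqrtr_ge0 ?spectral_norm_ge0// sqr_vnorm2.
by rewrite -scalemxAr qformZr exprVn sqr_vnorm2 mulrC ler_pdivrMr.
Qed.

(** A matrix and its transpose have the same operator bounds: with
    [z := A^T y], [|z|^2 = <y, A z> <= |y| |A z|]. *)
Lemma qform1_trmx_mulmx_le (R : realType) m n (A : 'M[R]_(m, n)) b : 0 <= b ->
  (forall x, qform 1 (A *m x) <= b * qform 1 x) ->
  forall y, qform 1 (A^T *m y) <= b * qform 1 y.
Proof.
move=> b0 Ab y; set z := A^T *m y.
have [z0|z0] := eqVneq z 0.
  by rewrite z0 {1}/qform mul0mx mulmx0 mxtrace0 mulr_ge0 ?qform1_ge0.
have qz : 0 < qform 1 z.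
  by exact: qform1_gt0.
have zE : qform 1 z = (y^T *m (A *m z)) 0 0.
  have -> : y^T *m (A *m z) = z^T *m z by rewrite mulmxA /z trmx_mul trmxK.
  by rewrite qformE mul1mx.
rewrite -(ler_pM2l qz) -expr2 {1}zE.
apply: le_trans (qform_cauchy_schwarz _ _) _.
rewrite mulrCA (mulrC (qform 1 z)) mulrA (mulrC b) -mulrA.
by rewrite ler_wpM2l ?qform1_ge0.
Qed.

Lemma qform_gram_le (R : realType) m n (A : 'M[R]_(m, n)) x :
  qform (A *m A^T) x <= spectral_norm A ^+ 2 * qform 1 x.
Proof.
rewrite qform_gram; apply: qform1_trmx_mulmx_le; first exact: sqr_ge0.
exact: qform1_mulmx_le.
Qed.

Lemma spectral_norm_le_frobenius (R : realType) m n (A : 'M[R]_(m, n)) :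
  spectral_norm A <= frobenius_norm A.
Proof.
apply: spectral_norm_le; first exact: sqrtr_ge0.
exact: qform1_mulmx_le_frobenius.
Qed.

Lemma sqr_spectral_norm_le_gram (R : realType) m n (A : 'M[R]_(m, n)) :
  spectral_norm A ^+ 2 <= spectral_norm (A *m A^T).
Proof.
set tau := spectral_norm (A *m A^T).
have tau0 : 0 <= tau by apply: spectral_norm_ge0.
suff : spectral_norm A <= Num.sqrt tau.
  by rewrite -(ler_pXn2r (n := 2)) ?nnegrE ?sqrtr_ge0 ?spectral_norm_ge0// sqr_sqrtr.
apply: spectral_norm_le; first exact: sqrtr_ge0.
rewrite sqr_sqrtr// -{1}(trmxK A); apply: qform1_trmx_mulmx_le => // x.
rewrite -qform_gram.
have : qform (A *m A^T) x ^+ 2 <= (tau * qform 1 x) ^+ 2.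
  rewrite qformE.
  apply: le_trans (qform_cauchy_schwarz _ _) _.
  apply: le_trans (ler_wpM2l (qform1_ge0 x) (qform1_mulmx_le _ x)) _.
  by rewrite -/tau exprMn mulrCA -expr2.
rewrite ler_pXn2r// nnegrE; last by rewrite mulr_ge0 ?qform1_ge0.
by rewrite qform_gram qform1_ge0.
Qed.

Lemma spectral_norm_sym_le (R : realType) n (Y : 'M[R]_n) b : 0 <= b -> Y^T = Y ->
  (forall x, `|qform Y x| <= b * qform 1 x) -> spectral_norm Y <= b.
Proof.
move=> b0 sY Yb; apply: spectral_norm_le => // x.
have [lam [w [w1 Yw]]] := sym_eigenframe sY.
have YYw k : (Y *m Y) *m w k = lam k ^+ 2 *: w k.
  by rewrite -mulmxA Yw -scalemxAr Yw scalerA.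
rewrite -{1}sY -{1}(trmxK Y) -qform_gram trmxK sY.
rewrite (frame_qform w1 _ YYw) (frame_parseval w1) mulr_sumr.
apply: ler_sum => k _; have [->|lamb] := eigen_bound Yb (Yw k).
  by rewrite /qform mul0mx mulmx0 mxtrace0 !mulr0.
rewrite ler_wpM2r// ?qform_rank1 ?sqr_ge0//.
by rewrite -[lam k ^+ 2]real_normK ?num_real// lerXn2r ?nnegrE.
Qed.

(** * The law of the sampled indices *)

(** Independence over the full index set gives the law of the whole tuple, on
    which every event considered here depends. *)
Lemma iid_probability (R : realType) (d : measure_display) (T : measurableType d)
    (P : probability T R) n c (p : 'I_n -> R) (t : 'I_c -> T -> 'I_n)
    (Q : ('I_c -> 'I_n) -> Prop) : iid_indices P p t ->
  P [set w | Q (fun j => t j w)] =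
    (\sum_(s : {ffun 'I_c -> 'I_n}) (\prod_j p (s j)) * `[< Q s >]%:R)%:E.
Proof.
move=> [mt Pt indep].
pose cyl (s : {ffun 'I_c -> 'I_n}) := [set w | forall j, t j w = s j].
have cylE s : cyl s = \bigcap_(j in [set` [set: 'I_c]%SET]) (t j @^-1` [set s j]).
  apply/seteqP; split=> w /=; first by move=> ws j _; apply: ws.
  by move=> ws j; apply: ws; rewrite /= inE.
have mcyl s : measurable (cyl s).
  rewrite cylE; apply: fin_bigcap_measurable => [|j _].
    exact: finite_finset.
  exact: mt.
have Pcyl s : P (cyl s) = (\prod_j p (s j))%:E.
  rewrite cylE indep -prodEFin; apply: eq_big => [j|j _]; first by rewrite inE.
  exact: Pt.
pose good : pred {ffun 'I_c -> 'I_n} := fun s => `[< Q s >].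
have -> : [set w | Q (fun j => t j w)] = \bigcup_(s in [set` good]) cyl s.
  apply/seteqP; split=> w /=.
    move=> Qw; exists [ffun j => t j w] => /=; last by move=> j; rewrite ffunE.
    apply/asboolP.
    suff -> : [ffun j => t j w] = (fun j => t j w) :> ('I_c -> 'I_n) by [].
    by apply/funext => j; rewrite ffunE.
  move=> [s /= /asboolP Qs ws].
  suff -> : (fun j => t j w) = s :> ('I_c -> 'I_n) by [].
  by apply/funext => j; apply: ws.
rewrite measure_fin_bigcup//=.
- rewrite -(@bigfs _ _ _ _ (index_enum _)) ?index_enum_uniq//; last first.
    by move=> s _; rewrite mem_index_enum.
  rewrite big_mkcond -sumEFin; apply: eq_bigr => s _ /=.
  by rewrite Pcyl /good; case: asboolP => [Qs|Qs]; rewrite ?mulr1 ?mulr0.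
- by move=> s s' _ _ [w [/= ws ws']]; apply/ffunP => j; rewrite -ws -ws'.
Qed.

(** * Centered samples of the Gram matrix *)

Definition centered_sample (R : realType) m n (A : 'M[R]_(m, n)) (p : 'I_n -> R)
    (c : nat) (i : 'I_n) : 'M[R]_m :=
  c%:R^-1 *: ((p i)^-1 *: (col i A *m (col i A)^T) - A *m A^T).

Lemma gram_sum_col (R : realType) m n (A : 'M[R]_(m, n)) :
  A *m A^T = \sum_i col i A *m (col i A)^T.
Proof.
apply/matrixP => a b; rewrite summxE mxE; apply: eq_bigr => i _.
by rewrite !mxE big_ord1 !mxE.
Qed.

Lemma sampled_gram_sum (R : realType) m n c (A : 'M[R]_(m, n)) (p : 'I_n -> R)
    (s : 'I_c -> 'I_n) : (forall i, 0 <= p i) -> (0 < c)%N ->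
  sampled_gram A p s - A *m A^T = \sum_j centered_sample A p c (s j).
Proof.
move=> p0 c0; have cn0 : c%:R != 0 :> R by rewrite pnatr_eq0 -lt0n.
rewrite /centered_sample -scaler_sumr sumrB scalerBr sumr_const card_ord.
rewrite -[_ *m _ *+ c]scaler_nat scalerA mulVf// scale1r; congr (_ - _).
rewrite /sampled_gram gram_sum_col scaler_sumr; apply: eq_bigr => j _.
rewrite scalerA -invfM.
have -> : col j (A *m sampling_matrix p s) =
    (Num.sqrt (c%:R * p (s j)))^-1 *: col (s j) A.
  apply/matrixP => a b; rewrite !mxE (bigD1 (s j))//= big1 => [|i ij].
    by rewrite !mxE eqxx mul1r addr0 mulrC.
  by rewrite !mxE (negPf ij) mul0r mulr0.
rewrite linearZ /= -scalemxAl -scalemxAr scalerA -expr2 exprVn sqr_sqrtr//.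
by rewrite mulr_ge0.
Qed.

Section CenteredSample.
Variables (R : realType) (m n : nat) (A : 'M[R]_(m, n)).
Hypothesis A_neq0 : A != 0.
Variables (beta : R) (p : 'I_n -> R).
Hypotheses (beta_gt0 : 0 < beta) (beta_le1 : beta <= 1).
Hypothesis p_opt : nearly_optimal A beta p.
Variable c : nat.
Hypothesis c_gt0 : (0 < c)%N.

Let F : R := frobenius_norm A ^+ 2.
Let sig2 : R := spectral_norm A ^+ 2.
Let u i := col i A.
Let U i := u i *m (u i)^T.
Let M := A *m A^T.
Let X := centered_sample A p c.

Lemma sampling_prob_ge0 i : 0 <= p i. Proof. by case: p_opt. Qed.

Lemma sqr_spectral_norm_gt0 : 0 < sig2.
Proof.
rewrite lt_def sqr_ge0 andbT; apply: contra_neq A_neq0 => s0.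
apply/matrixP => a b; rewrite mxE.
have := qform1_mulmx_le A (delta_mx b 0); rewrite -/sig2 s0 mul0r => q0.
have /qform1_eq0 : qform 1 (A *m delta_mx b 0) = 0.
  by apply/eqP; rewrite eq_le q0 qform1_ge0.
by rewrite -colE => /matrixP/(_ a 0); rewrite !mxE.
Qed.

Lemma sqr_spectral_le_frobenius : sig2 <= F.
Proof.
rewrite /sig2 /F lerXn2r ?nnegrE ?spectral_norm_ge0//; first exact: sqrtr_ge0.
exact: spectral_norm_le_frobenius.
Qed.

Lemma sqr_frobenius_gt0 : 0 < F.
Proof. exact: lt_le_trans sqr_spectral_norm_gt0 sqr_spectral_le_frobenius. Qed.

Lemma col_sqr_le i : qform 1 (u i) <= F / beta * p i.
Proof.
have [_ _ /(_ i)] := p_opt; rewrite sqr_vnorm2 -/F -/(u i).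
rewrite mulrA ler_pdivrMr ?sqr_frobenius_gt0// mulrC -ler_pdivlMr//.
have -> : p i * F / beta = F / beta * p i by ring.
by [].
Qed.

(** An index of probability zero has a null column, by near optimality, so the
    convention [0^-1 = 0] is harmless. *)
Lemma mulVp_col i : p i * (p i)^-1 *: U i = U i.
Proof.
have [p0|p0] := eqVneq (p i) 0; last by rewrite mulfV// scale1r.
have : qform 1 (u i) = 0.
  apply/eqP; rewrite eq_le qform1_ge0 andbT.
  by have := col_sqr_le i; rewrite p0 mulr0.
by move/qform1_eq0 => u0; rewrite /U u0 mul0mx scaler0.
Qed.

Lemma col_ratio_le i : (p i)^-1 * qform 1 (u i) <= F / beta.
Proof.
have Fb : 0 <= F / beta by rewrite divr_ge0 ?ltW ?sqr_frobenius_gt0.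
have [p0|p0] := eqVneq (p i) 0; first by rewrite p0 invr0 mul0r.
by rewrite mulrC ler_pdivrMr ?col_sqr_le// lt_def p0 sampling_prob_ge0.
Qed.

Lemma centered_sample_sym i : (X i)^T = X i.
Proof. by rewrite linearZ /= linearB /= linearZ /= !trmx_mul !trmxK. Qed.

Lemma centered_sample_mean0 : \sum_i p i *: X i = 0.
Proof.
have [_ p1 _] := p_opt.
transitivity (c%:R^-1 *: (\sum_i U i - M)); last first.
  by rewrite /M gram_sum_col subrr scaler0.
have -> : \sum_i U i - M = \sum_i U i - \sum_i p i *: M.
  by rewrite -scaler_suml p1 scale1r.
rewrite -sumrB scaler_sumr; apply: eq_bigr => i _.
rewrite /X /centered_sample -/(U i) -/M scalerA [p i * _]mulrC -scalerA.
by rewrite scalerBr scalerA mulVp_col.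
Qed.

(** Both [U i / p i] and [M] lie between [0] and [F / beta], so their difference
    does not exceed [F / beta] in absolute value. *)
Lemma centered_sample_bound i x : `|qform (X i) x| <= F / (beta * c%:R) * qform 1 x.
Proof.
have q0 := qform1_ge0 x.
have M0 : 0 <= qform M x by rewrite qform_gram qform1_ge0.
have ci : 0 <= c%:R^-1 :> R by rewrite invr_ge0.
have Mle : qform M x <= F / beta * qform 1 x.
  apply: le_trans (qform_gram_le A x) _; rewrite ler_wpM2r//.
  apply: le_trans sqr_spectral_le_frobenius _.
  by rewrite ler_peMr ?invf_ge1// ltW// sqr_frobenius_gt0.
have U0 : 0 <= (p i)^-1 * qform (U i) x.
  by rewrite mulr_ge0 ?invr_ge0 ?sampling_prob_ge0// qform_rank1 sqr_ge0.
have Ule : (p i)^-1 * qform (U i) x <= F / beta * qform 1 x.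
  apply: (@le_trans _ _ ((p i)^-1 * (qform 1 (u i) * qform 1 x))).
    rewrite ler_wpM2l ?invr_ge0 ?sampling_prob_ge0// qform_rank1.
    exact: qform_cauchy_schwarz.
  by rewrite mulrA ler_wpM2r// col_ratio_le.
rewrite /X /centered_sample qformZ qformD qformN qformZ -/(U i) -/M.
rewrite normrM ger0_norm//.
have -> : F / (beta * c%:R) * qform 1 x = c%:R^-1 * (F / beta * qform 1 x).
  by rewrite invfM; ring.
by rewrite ler_wpM2l// ler_norml; apply/andP; split; lra.
Qed.

Lemma sqr_centered_sample i : p i *: X i ^+ 2 =
  c%:R^-1 ^+ 2 *: (((p i)^-1 * qform 1 (u i)) *: U i - U i * M - M * U i +
                   p i *: (M * M)).
Proof.
have UU : U i * U i = qform 1 (u i) *: U i.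
  rewrite /U -[LHS]/(_ *m _) mulmxA -(mulmxA _ _ (u i)) [_^T *m _]mx11_scalar.
  by rewrite mul_mx_scalar -scalemxAl qformE mul1mx.
rewrite /X /centered_sample -/(U i) -/M.
have sqrZ a (Z : 'M[R]_m) : (a *: Z) ^+ 2 = a ^+ 2 *: (Z * Z).
  by rewrite expr2 -[LHS]/(_ *m _) -scalemxAl -scalemxAr scalerA -expr2.
rewrite sqrZ scalerA mulrC -[LHS]scalerA; congr (_ *: _).
have expand (Z W : 'M[R]_m) : (Z - W) * (Z - W) = Z * Z - Z * W - W * Z + W * W.
  by rewrite mulrBl !mulrBr opprB addrA addrAC.
rewrite expand scalerDr !scalerBr.
have -> : ((p i)^-1 *: U i) * ((p i)^-1 *: U i) =
    ((p i)^-1 * (p i)^-1) *: (U i * U i).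
  by rewrite -[LHS]/(_ *m _) -scalemxAl -scalemxAr scalerA.
have -> : ((p i)^-1 *: U i) * M = (p i)^-1 *: (U i * M).
  by rewrite -[LHS]/(_ *m _) -scalemxAl.
have -> : M * ((p i)^-1 *: U i) = (p i)^-1 *: (M * U i).
  by rewrite -[LHS]/(_ *m _) -scalemxAr.
have pU (Z : 'M[R]_m) : p i *: ((p i)^-1 *: (U i * Z)) = U i * Z.
  by rewrite scalerA -[in RHS](mulVp_col i) -[RHS]/(_ *m _) -scalemxAl.
have pU' (Z : 'M[R]_m) : p i *: ((p i)^-1 *: (Z * U i)) = Z * U i.
  by rewrite scalerA -[in RHS](mulVp_col i) -[RHS]/(_ *m _) -scalemxAr.
rewrite pU pU' UU.
have -> : p i *: ((p i)^-1 * (p i)^-1 *: (qform 1 (u i) *: U i)) =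
    (p i)^-1 * qform 1 (u i) *: U i.
  by rewrite -[in RHS](mulVp_col i) !scalerA; congr (_ *: _); ring.
by [].
Qed.

(** [U i ^ 2 = |u i|^2 U i], and near optimality bounds [|u i|^2 / p i] by
    [F / beta]; centering contributes [- M ^ 2], which only decreases the
    variance. *)
Lemma centered_sample_var :
  psd (F / (beta * c%:R ^+ 2) *: M - \sum_i p i *: X i ^+ 2).
Proof.
have [_ p1 _] := p_opt.
have sU : \sum_i U i = M by rewrite /M gram_sum_col.
have -> : \sum_i p i *: X i ^+ 2 =
    c%:R^-1 ^+ 2 *: (\sum_i ((p i)^-1 * qform 1 (u i)) *: U i - M * M).
  under eq_bigr => i _ do rewrite sqr_centered_sample.
  rewrite -scaler_sumr; congr (_ *: _).
  rewrite big_split /= !sumrB -scaler_suml p1 scale1r.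
  have -> : \sum_i U i * M = M * M by rewrite -[in RHS]sU mulr_suml sU.
  have -> : \sum_i M * U i = M * M by rewrite -mulr_sumr sU.
  by rewrite subrK.
move=> x; rewrite qformD qformN !qformZ qformD qformN qform_sum.
have -> : F / (beta * c%:R ^+ 2) * qform M x =
    c%:R^-1 ^+ 2 * (\sum_i F / beta * qform (U i) x).
  by rewrite -mulr_sumr -qform_sum sU invfM exprVn; ring.
rewrite -mulrBr mulr_ge0 ?sqr_ge0// opprB addrCA -sumrB.
rewrite addr_ge0//.
  have sM : M^T = M by rewrite /M trmx_mul trmxK.
  by rewrite -{2}sM qform_gram qform1_ge0.
apply: sumr_ge0 => i _; rewrite qformZ -mulrBl mulr_ge0//.
  by rewrite subr_ge0 col_ratio_le.
by rewrite qform_rank1 sqr_ge0.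
Qed.

Lemma gram_le_sqr_spectral b : 0 <= b -> psd ((b * sig2) *: (1 : 'M[R]_m) - b *: M).
Proof.
move=> b0 x; rewrite qformD qformN !qformZ -mulrA -mulrBr mulr_ge0// subr_ge0.
exact: qform_gram_le.
Qed.

Lemma mxtrace_gram : \tr M = F.
Proof.
rewrite /M gram_sum_col raddf_sum /F sqr_frobenius_norm; apply: eq_bigr => i _ /=.
by rewrite /qform mul1mx.
Qed.

Variable eps : R.
Hypothesis eps_gt0 : 0 < eps.

(** Half of the threshold of the rescaled deviation; also the exponent in the
    bound on its moment generating function. *)
Definition tail_exponent : R :=
  c%:R * (beta * eps ^+ 2) / (c0 eps * stable_rank A).

(** The value [t / (v + L t / 3)] at which Bernstein's bound for the deviation [t]
    is evaluated, with [v] the variance of the sum, [L] the bound on its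
    summands and [t = eps * spectral_norm A ^+ 2]. *)
Definition laplace_parameter : R := c%:R * beta * eps / (F * (1 + eps / 3)).

(** Taking [e] to be [1] or [-1] gives the upper or the lower tail. *)
Lemma centered_sample_tail e : e ^+ 2 = 1 ->
  iid_prob p (fun i => (e * laplace_parameter) *: X i) c
    (fun Y => exists2 x, qform 1 x = 1 & 2 * tail_exponent <= qform Y x) *
  (expR (2 * tail_exponent) - 1 - 2 * tail_exponent) <=
  stable_rank A * (expR tail_exponent - 1).
Proof.
move=> e2; set th := laplace_parameter.
have [_ p1 _] := p_opt.
have F0 := sqr_frobenius_gt0; have s0 := sqr_spectral_norm_gt0.
have e3 : 0 < 1 + eps / 3 by rewrite addr_gt0// divr_gt0.
have cn : 0 < c%:R :> R by rewrite ltr0n.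
have th0 : 0 <= th.
  by rewrite ltW// divr_gt0// ?(mulr_gt0 F0 e3)// mulr_gt0// mulr_gt0.
have eth2 : (e * th) ^+ 2 = th ^+ 2 by rewrite exprMn e2 mul1r.
have sr0 : 0 < stable_rank A by rewrite divr_gt0.
have alpha0 : 0 <= tail_exponent.
  have c00 : 0 < c0 eps by rewrite /c0 addr_gt0// divr_gt0// mulr_gt0.
  rewrite /tail_exponent divr_ge0//; last by rewrite ltW// mulr_gt0.
  by rewrite mulr_ge0// mulr_ge0 ?sqr_ge0// ltW.
set b := th ^+ 2 * (F / (beta * c%:R ^+ 2)).
have b0 : 0 <= b by rewrite mulr_ge0 ?sqr_ge0// divr_ge0 ?ltW// mulr_gt0 ?exprn_gt0.
set L := eps / (1 + eps / 3).
have L3 : L < 3 by rewrite ltr_pdivrMr//; lra.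
have F0' : F != 0 by rewrite gt_eqF.
have s0' : spectral_norm A != 0 by apply: contraTneq s0 => h; rewrite /sig2 h expr0n ltxx.
have aE : tail_exponent = c%:R * ((2 * (1 - L / 3))^-1 * (b * sig2)).
  rewrite /tail_exponent /b /th /L /laplace_parameter /stable_rank /sig2 -/F /c0.
  have h1 : 3 + eps != 0 by rewrite gt_eqF// addr_gt0.
  have h2 : 6 + 2 * eps != 0 by rewrite gt_eqF// addr_gt0// mulr_gt0.
  have h3 : 3 + eps - eps != 0 by rewrite addrK pnatr_eq0.
  by field; rewrite F0' s0' h1 h2 h3 (gt_eqF cn) (gt_eqF beta_gt0).
rewrite {4}aE.
apply: (@bernstein_intdim _ _ _ _ _ _ _ _ _ L (b * sig2) (stable_rank A) (b *: M)) => //.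
- exact: sampling_prob_ge0.
- by move=> i; rewrite linearZ /= centered_sample_sym.
- under eq_bigr => i _ do rewrite scalerA mulrC -scalerA.
  by rewrite -scaler_sumr centered_sample_mean0 scaler0.
- move=> i x; rewrite qformZ normrM.
  have -> : `|e * th| = th.
    by apply/eqP; rewrite -(eqrXn2 (n := 2))// real_normK ?num_real ?eth2.
  apply: le_trans (ler_wpM2l th0 (centered_sample_bound i x)) _.
  rewrite mulrA le_eqVlt; apply/orP; left; apply/eqP; congr (_ * _).
  rewrite /th /laplace_parameter /L; field.
  by rewrite F0' (gt_eqF cn) (gt_eqF beta_gt0) /=; lra.
- have -> : b *: M - \sum_i p i *: ((e * th) *: X i) ^+ 2 =
     th ^+ 2 *: (F / (beta * c%:R ^+ 2) *: M - \sum_i p i *: X i ^+ 2).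
    rewrite scalerBr scalerA -/b scaler_sumr; congr (_ - _); apply: eq_bigr => i _.
    rewrite [((e * th) *: X i) ^+ 2]expr2 [X i ^+ 2]expr2.
    rewrite -[(_ *: X i) * _]/(_ *m _) -scalemxAl -scalemxAr !scalerA.
    by congr (_ *: _); rewrite -eth2; ring.
  exact/psdZ/centered_sample_var/sqr_ge0.
- exact: gram_le_sqr_spectral.
- by rewrite mxtraceZ mxtrace_gram /stable_rank -/F -/sig2 [leRHS]mulrCA divfK ?gt_eqF.
- by rewrite mulr_ge0 // ltW.
- by rewrite ltW.
- by rewrite mulr_ge0.
Qed.

End CenteredSample.

(** * The two-sided tail *)

(** Here [E := expR alpha] is at least [4 s / delta >= 4]; hence
    [s (E - 1) <= delta E^2 / 4], while [E^2 >= 4 (1 + alpha)] shows that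
    [E^2 - 1 - 2 alpha >= E^2 / 2]. *)
Lemma tail_prob_le (R : realType) (s delta alpha q : R) :
  1 <= s -> 0 < delta -> delta < 1 ->
  ln (4 * s / delta) <= alpha -> 0 <= q ->
  q * (expR (2 * alpha) - 1 - 2 * alpha) <= s * (expR alpha - 1) -> q <= delta / 2.
Proof.
move=> s1 d0 d1 la q0; set E := expR alpha.
have sd : 0 < 4 * s / delta by rewrite divr_gt0// mulr_gt0// (lt_le_trans ltr01).
have E1 : 4 * s / delta <= E.
  by rewrite -[leLHS](@lnK R) ?posrE// ler_expR.
have sE : s <= delta * E / 4 by move: E1; rewrite ler_pdivrMr//; lra.
have E4 : 4 <= E.
  apply: le_trans E1; rewrite ler_pdivlMr//; nra.
have Ea : 1 + alpha <= E by apply: expR_ge1Dx.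
rewrite expRM_natl -/E => H.
have H1 : s * (E - 1) <= delta * E / 4 * (E - 1) by rewrite ler_wpM2r//; lra.
have H2 : q * (E ^+ 2 / 2) <= q * (E ^+ 2 - 1 - 2 * alpha) by rewrite ler_wpM2l//; nra.
have H3 : delta * E / 4 * (E - 1) <= delta / 2 * (E ^+ 2 / 2) by nra.
have E20 : 0 < E ^+ 2 / 2 by rewrite divr_gt0// exprn_gt0//; lra.
by rewrite -(ler_pM2r E20); lra.
Qed.

Lemma spectral_norm_sym_gt (R : realType) n (Y : 'M[R]_n) b : 0 <= b -> Y^T = Y ->
  ~~ (spectral_norm Y <= b) ->
  exists2 x, qform 1 x = 1 & b <= `|qform Y x|.
Proof.
move=> b0 sY Yb; apply: contrapT => noex; move/negP: Yb; apply.
apply: spectral_norm_sym_le => // x.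
have [->|x0] := eqVneq x 0.
  by rewrite /qform !mul0mx !mulmx0 !mxtrace0 normr0 mulr0.
have qx : 0 < qform 1 x.
  by exact: qform1_gt0.
rewrite leNgt; apply/negP => xb; apply: noex.
exists ((vnorm2 x)^-1 *: x).
  by rewrite qformZr exprVn sqr_vnorm2 mulVf// gt_eqF.
rewrite qformZr exprVn sqr_vnorm2 normrM ger0_norm; last by rewrite invr_ge0 ltW.
by rewrite [leRHS]mulrC ler_pdivlMr// ltW.
Qed.

Theorem theorem4p2 (R : realType) (m n : nat) (A : 'M[R]_(m, n))
    (A_neq0 : A != 0)
    (beta : R) (beta_gt0 : 0 < beta) (beta_le1 : beta <= 1)
    (p : 'I_n -> R) (p_opt : nearly_optimal A beta p)
    (c : nat) (c_range : (1 <= c <= n)%N)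
    (d : measure_display) (T : measurableType d) (P : probability T R)
    (t : 'I_c -> T -> 'I_n) (t_iid : iid_indices P p t)
    (delta eps : R)
    (delta_gt0 : 0 < delta) (delta_lt1 : delta < 1)
    (eps_gt0 : 0 < eps) (eps_le1 : eps <= 1)
    (c_large : c0 eps * stable_rank A *
       (ln (4 * stable_rank A / delta) / (beta * eps ^+ 2)) <= c%:R) :
  ((1 - delta)%:E <=
     P [set w | (spectral_norm
                   (sampled_gram A p (fun j => t j w) - A *m A^T)
                 / spectral_norm (A *m A^T) <= eps)%R])%E.
Proof.
have c_gt0 : (0 < c)%N by case/andP: c_range.
have [p0 p1 _] := p_opt.
pose good (s : 'I_c -> 'I_n) : Prop := spectral_norm (sampled_gram A p s - A *m A^T)
  / spectral_norm (A *m A^T) <= eps.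
rewrite (iid_probability good t_iid) lee_fin.
set sig2 := spectral_norm A ^+ 2; set F := frobenius_norm A ^+ 2.
have sig0 : 0 < sig2 := sqr_spectral_norm_gt0 A_neq0.
have F0 : 0 < F := sqr_frobenius_gt0 A_neq0.
have s1 : 1 <= stable_rank A.
  by rewrite /stable_rank ler_pdivlMr// mul1r sqr_spectral_le_frobenius.
set alpha := tail_exponent A beta c eps; set th := laplace_parameter A beta c eps.
have cn : 0 < c%:R :> R by rewrite ltr0n.
have e3 : 0 < 1 + eps / 3 by rewrite addr_gt0// divr_gt0.
have th0 : 0 < th by rewrite divr_gt0// mulr_gt0// mulr_gt0.
have c00 : 0 < c0 eps by rewrite /c0 addr_gt0// divr_gt0// mulr_gt0.
have alpha_ge : ln (4 * stable_rank A / delta) <= alpha.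
  rewrite /alpha /tail_exponent.
  have cs0 : 0 < c0 eps * stable_rank A by rewrite mulr_gt0// (lt_le_trans ltr01).
  have be0 : 0 < beta * eps ^+ 2 by rewrite mulr_gt0// exprn_gt0.
  rewrite ler_pdivlMr// [leLHS]mulrC -ler_pdivrMr//.
  by apply: le_trans c_large; rewrite (mulrA (_ * _)).
have alphaE : 2 * alpha = th * (eps * sig2).
  rewrite /alpha /th /tail_exponent /laplace_parameter /stable_rank -/F -/sig2 /c0.
  have h1 : 3 + eps != 0 by rewrite gt_eqF// addr_gt0.
  have h2 : 6 + 2 * eps != 0 by rewrite gt_eqF// addr_gt0// mulr_gt0.
  by field; rewrite ?(gt_eqF F0) ?(gt_eqF sig0) h1 h2.
pose X := centered_sample A p c.
pose E (Y : 'M[R]_m) := exists2 x, qform 1 x = 1 & 2 * alpha <= qform Y x.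
have tail e : e ^+ 2 = 1 -> iid_prob p (fun i => (e * th) *: X i) c E <= delta / 2.
  move=> e2; apply: (tail_prob_le s1 delta_gt0 delta_lt1 alpha_ge).
    by apply: sumr_ge0 => u _; rewrite mulr_ge0 ?prodr_ge0.
  exact: centered_sample_tail.
have tail1 := tail 1 (expr1n _ _).
have tail2 : iid_prob p (fun i => (-1 * th) *: X i) c E <= delta / 2.
  by apply: tail; rewrite sqrrN expr1n.
have tot := iid_mean1 X p1 c; rewrite /iid_mean in tot.
(* A bad outcome violates one of the two one-sided bounds *)
suff : \sum_(s : {ffun 'I_c -> 'I_n}) (\prod_j p (s j)) * 1 <=
   \sum_(s : {ffun 'I_c -> 'I_n}) (\prod_j p (s j)) * `[< good s >]%:R +
   (iid_prob p (fun i => (1 * th) *: X i) c E +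
    iid_prob p (fun i => (-1 * th) *: X i) c E).
  by rewrite tot; lra.
rewrite /iid_prob /iid_mean -!big_split /=; apply: ler_sum => s _.
rewrite -!mulrDr ler_wpM2l ?prodr_ge0//.
case: (asboolP (good s)) => [gs|bs].
  by rewrite lerDl addr_ge0.
rewrite add0r; set Y := \sum_j X (s j).
have sY : Y^T = Y.
  by rewrite raddf_sum; apply: eq_bigr => j _; rewrite /= centered_sample_sym.
have [x x1 xY] : exists2 x, qform 1 x = 1 & eps * sig2 <= `|qform Y x|.
  apply: spectral_norm_sym_gt => //; first by rewrite mulr_ge0// ltW.
  apply/negP => Yle; apply: bs; rewrite /good sampled_gram_sum// -/Y.
  have gram_ge := sqr_spectral_norm_le_gram A.
  rewrite ler_pdivrMr ?(lt_le_trans sig0)//.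
  by apply: (le_trans Yle); rewrite ler_wpM2l// ltW.
have sgn e : 2 * alpha <= e * th * qform Y x -> E (\sum_j (e * th) *: X (s j)).
  by move=> h; exists x => //; rewrite -scaler_sumr qformZ.
rewrite alphaE in sgn.
have [Yx|Yx] := lerP 0 (qform Y x).
  rewrite ger0_norm// in xY.
  have /asboolT -> : E (\sum_j (1 * th) *: X (s j)).
    by apply: sgn; rewrite mul1r ler_wpM2l// ltW.
  by rewrite lerDl.
rewrite ltr0_norm// in xY.
have /asboolT -> : E (\sum_j (-1 * th) *: X (s j)).
  by apply: sgn; rewrite mulN1r mulNr -mulrN ler_wpM2l// ltW.
by rewrite lerDr.
Qed.
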